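(* Let $s$ be a positive integer and let $G$ be a connected $S(K_{1,2s+1})$-free graph of order at least three. Then $G^2$ has a $[2,2s]$-factor.
   Context: All graphs are finite, simple and undirected. The square $G^2$ of a graph $G$ is the graph on $V(G)$ in which two distinct vertices are adjacent if and only if their distance in $G$ is at most two. For a positive integer $s$, $S(K_{1,2s+1})$ is the graph obtained from the complete bipartite graph $K_{1,2s+1}$ by subdividing each edge exactly once. A graph is $S(K_{1,2s+1})$-free if it contains no induced subgraph isomorphic to $S(K_{1,2s+1})$. A factor of a graph is a spanning subgraph; an even factor is a factor in which every vertex has even degree. A $[2,2s]$-factor of a graph is a connected even factor in which every vertex has degree at most $2s$. *)

(* Defs.v *)
From HB Require Import structures.
From mathcomp Require Import all_boot.

Set Implicit Arguments.
Unset Strict Implicit.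
Unset Printing Implicit Defensive.

(* Graphs are indexed by their vertex type, so that a graph and its spanning
   subgraphs all live in [sgraph V]. *)
Record sgraph (V : finType) := SGraph {
  adj :> rel V;
  adj_sym : symmetric adj;
  adj_irr : irreflexive adj
}.

Definition connected (V : finType) (G : sgraph V) : Prop :=
  0 < #|V| /\ forall x y : V, connect G x y.

Definition degree (V : finType) (G : sgraph V) (x : V) : nat :=
  #|[set y | G x y]|.

Section Square.
Variables (V : finType) (G : sgraph V).

Definition walk (x y : V) (k : nat) : bool :=
  [exists p : k.-tuple V, path G x p && (last x p == y)].

Lemma connect_walk (x y : V) : connect G x y -> exists k, walk x y k.
Proof.
case/connectP => p pathp ->; exists (size p).
by apply/existsP; exists (in_tuple p); rewrite /= pathp eqxx.
Qed.

Lemma walk_sym (x y : V) (k : nat) : walk x y k = walk y x k.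
Proof.
suff imp a b : walk a b k -> walk b a k by apply/idP/idP; apply: imp.
case/existsP => p /andP[pathp /eqP <-].
have size_q : size (rev (belast a p)) == k.
  by rewrite size_rev size_belast size_tuple.
apply/existsP; exists (Tuple size_q) => /=.
rewrite rev_path (eq_path (e' := G)) ?pathp /=; last first.
  by move=> u v; rewrite adj_sym.
by case: (tval p) => [|c q] //=; rewrite rev_cons last_rcons.
Qed.

(* [None] stands for infinite distance. *)
Definition dist (x y : V) : option nat :=
  match @idP (connect G x y) with
  | ReflectT cxy => Some (ex_minn (connect_walk cxy))
  | ReflectF _ => None
  end.

Lemma dist_leP (d : nat) (x y : V) :
  reflect (exists2 k, k <= d & walk x y k)
          (if dist x y is Some k then k <= d else false).
Proof.
rewrite /dist; case: {-}_ / idP => [cxy | ncxy]; last first.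
  apply: ReflectF => -[k _ /existsP[p /andP[pathp /eqP lastp]]].
  by apply: ncxy; apply/connectP; exists p.
case: ex_minnP => m wm minm; apply: (iffP idP) => [led | [k lekd wk]].
  by exists m.
exact: leq_trans (minm k wk) lekd.
Qed.

Definition square_rel : rel V :=
  fun x y => (x != y) && (if dist x y is Some k then k <= 2 else false).

Lemma square_sym : symmetric square_rel.
Proof.
move=> x y; rewrite /square_rel eq_sym; congr (_ && _).
by apply/dist_leP/dist_leP => -[k lek wk]; exists k; rewrite // walk_sym.
Qed.

Lemma square_irr : irreflexive square_rel.
Proof. by move=> x; rewrite /square_rel eqxx. Qed.

Definition square : sgraph V := SGraph square_sym square_irr.

End Square.

Section Induced.
Variables (V : finType) (G : sgraph V) (A : {set V}).

Definition induced_rel : rel {x : V | x \in A} := fun x y => G (val x) (val y).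

Lemma induced_sym : symmetric induced_rel.
Proof. by move=> x y; apply: adj_sym. Qed.

Lemma induced_irr : irreflexive induced_rel.
Proof. by move=> x; apply: adj_irr. Qed.

Definition induced : sgraph {x : V | x \in A} := SGraph induced_sym induced_irr.

End Induced.

Definition isomorphic (V W : finType) (G : sgraph V) (H : sgraph W) : Prop :=
  exists2 f : V -> W, bijective f & forall x y : V, H (f x) (f y) = G x y.

Definition free (W V : finType) (H : sgraph W) (G : sgraph V) : Prop :=
  forall A : {set V}, ~ isomorphic (induced G A) H.

Section CompleteBipartite.
Variables m n : nat.

Definition Kmn_rel : rel ('I_m + 'I_n)%type := fun x y =>
  match x, y with
  | inl _, inr _ | inr _, inl _ => true
  | _, _ => false
  end.

Lemma Kmn_sym : symmetric Kmn_rel.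
Proof. by case=> ? [] ?. Qed.

Lemma Kmn_irr : irreflexive Kmn_rel.
Proof. by case. Qed.

Definition complete_bipartite : sgraph ('I_m + 'I_n)%type :=
  SGraph Kmn_sym Kmn_irr.

End CompleteBipartite.

Definition edges (V : finType) (G : sgraph V) : {set {set V}} :=
  [set [set p.1; p.2] | p : V * V & G p.1 p.2].

(* Subdividing every edge of G once: an edge, now a vertex of its own, is
   joined to precisely its two ends. *)
Section Subdivision.
Variables (V : finType) (G : sgraph V).

Definition subdivision_vertex : finType :=
  (V + {e : {set V} | e \in edges G})%type.

Definition subdivision_rel : rel subdivision_vertex := fun x y =>
  match x, y with
  | inl v, inr e | inr e, inl v => v \in val e
  | _, _ => false
  end.

Lemma subdivision_sym : symmetric subdivision_rel.
Proof. by case=> ? [] ?. Qed.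

Lemma subdivision_irr : irreflexive subdivision_rel.
Proof. by case. Qed.

Definition subdivision : sgraph subdivision_vertex :=
  SGraph subdivision_sym subdivision_irr.

End Subdivision.

Definition is_factor (V : finType) (G F : sgraph V) : Prop :=
  subrel F G.

Definition is_even_factor (V : finType) (G F : sgraph V) : Prop :=
  is_factor G F /\ forall x : V, ~~ odd (degree F x).

(* The [2,2s]-factors of G; the lower bound 2 on degrees is not imposed
   separately, as it follows from connectedness and evenness when |V| > 1. *)
Definition is_2_2s_factor (s : nat) (V : finType) (G F : sgraph V) : Prop :=
  [/\ is_even_factor G F, connected F & forall x : V, degree F x <= 2 * s].

(* Main.v *)
(* Root a breadth-first search tree at a vertex [r] of maximum degree. From the
   bottom up, the set of descendants of each [v] is spanned by a connected graph
   with even degrees, once two dangling half-edges are counted: one at [v] and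
   one at a child [d v] of [v] (at [v] itself if [v] has no child). For children
   [c], [c'] of [v], the first can be linked to the second when [c] and [d c']
   are within distance two. In the resulting digraph an independent set yields
   an induced subdivided star with centre [v] and legs [c], [d c]; as the way up
   to the root is a further leg, the independence number is less than [2s], and
   by the theorem of Gallai and Milgram fewer than [2s] directed paths cover the
   children. Each path is entered by an edge from [v], and its other end is
   paired up inside the neighbourhood of [v], which is a clique of the square.

   A neighbour [t] of [r] may lack the further leg. It always has one unless it
   comes first in its component of the complement of the neighbourhood of [r],
   if each vertex at distance two is given to its earliest neighbour. If a first
   vertex [t] needs [2s] paths, then by maximality of the degree of [r] there is
   a [mate] in the same component, and one of the paths can be chosen to start
   next to it; the branches of [mate] and [t] are linked through that path. *)

Require Import Defs.
From HB Require Import structures.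
From mathcomp Require Import all_boot zify.

Set Implicit Arguments.
Unset Strict Implicit.
Unset Printing Implicit Defensive.


(** * Path covers of a digraph and independent sets *)

Section GallaiMilgram.
Variables (T : finType) (e : rel T).

Definition nepath (p : seq T) : bool := if p is x :: q then path e x q else false.

Definition path_cover (A : {set T}) (P : seq (seq T)) : Prop :=
  [/\ all nepath P, uniq (flatten P) & flatten P =i A].

Definition starts (P : seq (seq T)) : seq T := pmap ohead P.

Definition independent (I : {set T}) : Prop :=
  {in I &, forall x y, x != y -> ~~ e x y}.

Lemma path_cover_perm A P Q : perm_eq P Q -> path_cover A P -> path_cover A Q.
Proof.
move=> pPQ [aP uP fP]; split.
- by rewrite -(perm_all _ pPQ).
- by rewrite -(perm_uniq (perm_flatten pPQ)).
- by move=> x; rewrite -fP (perm_mem (perm_flatten pPQ)).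
Qed.

Lemma perm_starts P x : x \in starts P -> exists p R, perm_eq P ((x :: p) :: R).
Proof.
rewrite mem_pmap => /mapP[[|y p] // pP [->]].
by exists p, (rem (y :: p) P); apply: perm_to_rem.
Qed.

Lemma path_cover_prepend (A : {set T}) x y p R :
  x \notin A -> e x y -> path_cover A ((y :: p) :: R) ->
  path_cover (x |: A) ((x :: y :: p) :: R).
Proof.
move=> xA exy [/= /andP[pp aR] uf ff]; split => /=.
- by rewrite exy pp.
- by rewrite uf andbT -(ff x) in xA *.
- by move=> z; rewrite !inE -ff.
Qed.

Lemma path_cover_add1 (A : {set T}) x R :
  x \notin A -> path_cover A R -> path_cover (x |: A) ([:: x] :: R).
Proof.
move=> xA [aR uf ff]; split => //=.
- by rewrite uf andbT ff.
- by move=> z; rewrite !inE -ff.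
Qed.

Lemma starts_sub_flatten P : {subset starts P <= flatten P}.
Proof.
move=> x; rewrite mem_pmap => /mapP[[|y p] // pP [->]].
by apply/flattenP; exists (y :: p); rewrite // mem_head.
Qed.

Lemma uniq_starts P : uniq (flatten P) -> uniq (starts P).
Proof.
rewrite /starts; elim: P => //= -[|x p] P IH //=.
case/andP; rewrite mem_cat negb_or => /andP[_ xP].
rewrite cat_uniq => /and3P[_ _ uP]; rewrite IH // andbT.
by apply: contra xP; apply: starts_sub_flatten.
Qed.

Lemma size_starts P : all nepath P -> size (starts P) = size P.
Proof. by elim: P => //= -[|x p] P IH //= /andP[_ /IH ->]. Qed.

(* The paths are prepended rather than appended to, so that the control is on
   the first vertices. *)
Lemma Gallai_Milgram (A : {set T}) P : path_cover A P ->
  exists Q (I : {set T}), [/\ path_cover A Q, {subset starts Q <= starts P},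
    I \subset A, independent I & size Q <= #|I|].
Proof.
(* A recursive call either deletes a vertex and keeps the number of paths, or keeps [A] and saves a
   path. *)
have [n] := ubnP (#|A| + size P); elim: n A P => // n IH A P ltn cP.
case: (boolP (has (fun x => has (fun y => (x != y) && e x y) (starts P))
                  (starts P))) => [/hasP[x xP /hasP[y yP /andP[nxy exy]]]|none].
  have [px [R1 pP1]] := perm_starts xP.
  have yR1 : y \in starts R1.
    by move: yP; rewrite (perm_mem (perm_pmap _ pP1)) /= inE eq_sym (negPf nxy).
  have [py [R pR1]] := perm_starts yR1.
  have pP : perm_eq P [:: x :: px, y :: py & R].
    by rewrite (perm_trans pP1) // perm_cons.
  have szP : size P = (size R).+2 by rewrite (perm_size pP).
  have sP : starts P =i [:: x, y & starts R] := perm_mem (perm_pmap _ pP).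
  have xA : x \in A.
    by case: cP => _ _ <-; apply: starts_sub_flatten.
  have cAx : path_cover (A :\ x) (if px is [::] then (y :: py) :: R
                                  else [:: px, y :: py & R]).
    have [/= /and3P[p1 p2 aR] /andP[xn uf] ff] := path_cover_perm pP cP.
    split.
    - by case: px p1 {xn uf ff pP pP1} => /= [_|z px /andP[_ ->]]; rewrite p2.
    - by case: px uf {p1 xn ff pP pP1} => /=.
    - move=> z; rewrite !inE -ff; case: eqP => [->|/eqP nzx] /=.
        by apply/negbTE; move: xn; case: px {p1 uf ff pP pP1}.
      by rewrite inE (negPf nzx); case: px {p1 uf ff pP pP1 xn}.
  have xAx : x \notin A :\ x by rewrite !inE eqxx.
  (* If [x] is a path by itself, it goes in front of the path of [y], which saves a path. Otherwise
     it is taken off its path and put back after the recursive call. *)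
  case: px cAx pP pP1 => [|z px] cAx pP pP1.
    have cA1 := path_cover_prepend xAx exy cAx; rewrite setD1K // in cA1.
    have [|Q [I [cQ sQ IA iI szQ]]] := IH _ _ _ cA1.
      by move: ltn; rewrite szP /=; clear; lia.
    exists Q, I; split => // u /sQ /=; rewrite sP !inE.
    by case/orP=> ->; rewrite ?orbT.
  have exz : e x z.
    by have [/= /andP[/andP[-> _] _] _ _] := path_cover_perm pP cP.
  have [|Q' [I [cQ' sQ' IA iI szQ']]] := IH _ _ _ cAx.
    by move: ltn; rewrite szP /= (cardsD1 x A) xA; clear; lia.
  have IA' : I \subset A by apply: subset_trans IA (subsetDl _ _).
  (* The last premise ensures that [z], the old successor of [x] and no first vertex in [P], does
     not remain a first vertex. *)
  have prepend w : e x w -> w \in starts Q' ->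
      (forall u, u \in starts Q' -> u != w -> u != z) ->
      exists Q (I : {set T}), [/\ path_cover A Q, {subset starts Q <= starts P},
        I \subset A, independent I & size Q <= #|I|].
    move=> exw /perm_starts[pw [R' pQ']] wz.
    have cS := path_cover_perm pQ' cQ'.
    have := path_cover_prepend xAx exw cS.
    rewrite setD1K // => cQ; exists ((x :: w :: pw) :: R'), I; split => //.
      move=> u; rewrite inE => /orP[/eqP-> //|uR'].
      have uQ' : u \in starts Q'.
        by rewrite (perm_mem (perm_pmap _ pQ')) inE uR' orbT.
      have uw : u != w.
        have [_ /= /andP[]] := cS; rewrite mem_cat negb_or => /andP[_ wR' _ _].
        by apply: contraNneq wR' => <-; apply: starts_sub_flatten.
      have := sQ' u uQ'; rewrite /= sP !inE (negPf (wz _ uQ' uw)) /=.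
      by case/orP=> ->; rewrite ?orbT.
    by move: szQ'; rewrite (perm_size pQ').
  have [zQ'|zQ'] := boolP (z \in starts Q').
    exact: prepend exz zQ' _.
  have nz u : u \in starts Q' -> u != z by apply: contraTneq => ->.
  have [yQ'|yQ'] := boolP (y \in starts Q').
    by apply: prepend exy yQ' _ => u /nz.
  (* Neither [z] nor [y] starts a path of [Q'], so even with [[:: x]] added there are fewer paths
     than in [P]. *)
  have sR : {subset starts Q' <= starts R}.
    move=> u uQ'; have := sQ' u uQ'; rewrite /= !inE (negPf (nz _ uQ')) /=.
    by case: eqP uQ' yQ' => [-> ->|].
  have cQ := path_cover_add1 xAx cQ'; rewrite setD1K // in cQ.
  have [aQ' uQ' _] := cQ'; have [aR _ _] := path_cover_perm pP cP.
  have szR : size Q' <= size R.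
    rewrite -(size_starts aQ') -(@size_starts R); last by case/and3P: aR.
    by apply: uniq_leq_size sR; apply: uniq_starts.
  have [|Q [J [cQ2 sQ2 JA iJ szQ]]] := IH _ _ _ cQ.
    by move: ltn szR; rewrite szP /=; clear; lia.
  exists Q, J; split => // u /sQ2 /=; rewrite sP !inE => /orP[->//|/sR ->].
  by rewrite !orbT.
have [aP uP fP] := cP; exists P, [set x in starts P]; split => //.
- by apply/subsetP=> x; rewrite inE -fP; apply: starts_sub_flatten.
- move=> x y; rewrite !inE => xP yP nxy; apply: contra none => exy.
  by apply/hasP; exists x => //; apply/hasP; exists y; rewrite ?nxy.
- by rewrite cardsE (card_uniqP (uniq_starts uP)) size_starts.
Qed.
End GallaiMilgram.

Lemma card_pairs_fst (T : finType) (es : seq (T * T)) x :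
  uniq es -> #|[set y | (x, y) \in es]| = count (fun p => p.1 == x) es.
Proof.
move=> ues; rewrite -size_filter -(size_map snd).
have ->: #|[set y | (x, y) \in es]| = #|[seq p.2 | p <- es & p.1 == x]|.
  apply: eq_card => y; rewrite inE; apply/idP/mapP => [yes|[[u v]]].
    by exists (x, y); rewrite // mem_filter eqxx.
  by rewrite mem_filter => /andP[/eqP/= -> ?] ->.
apply/card_uniqP; rewrite map_inj_in_uniq ?filter_uniq // => -[u v] [u' v'].
by rewrite !mem_filter /= => /andP[/eqP-> _] /andP[/eqP-> _] ->.
Qed.

Lemma card_pairs_snd (T : finType) (es : seq (T * T)) x :
  uniq es -> #|[set y | (y, x) \in es]| = count (fun p => p.2 == x) es.
Proof.
move=> ues; have swapK : injective (fun p : T * T => (p.2, p.1)).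
  by move=> [? ?] [? ?] [-> ->].
have := @card_pairs_fst T [seq (p.2, p.1) | p <- es] x.
rewrite map_inj_uniq // count_map => /(_ ues) <-.
by apply: eq_card => y; rewrite !inE -(mem_map swapK es (y, x)).
Qed.

(** * Segments: connected even graphs with two dangling half-edges *)

Section Segments.
Variables (V : finType) (G : sgraph V).
Implicit Types (F : sgraph V) (S : {set V}) (f : V -> nat).

Definition spans S F : Prop :=
  [/\ subrel F (square G), (forall x y, F x y -> x \in S)
    & {in S &, forall x y, connect F x y}].

Lemma spans_r S F x y : spans S F -> F x y -> y \in S.
Proof. by case=> _ sF _; rewrite adj_sym; apply: sF. Qed.

(** The new edges are listed as pairs directed from [S1] to [S2]. By disjointness none of them
    occurs in both directions, in [F1] or in [F2], so degrees add up. *)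
Lemma glue S1 S2 F1 F2 (es : seq (V * V)) :
    spans S1 F1 -> spans S2 F2 -> [disjoint S1 & S2] ->
    es != [::] -> uniq es ->
    (forall p, p \in es -> [&& p.1 \in S1, p.2 \in S2 & square G p.1 p.2]) ->
  exists2 F, spans (S1 :|: S2) F &
    forall x, degree F x = degree F1 x + degree F2 x
                + count (fun p => p.1 == x) es + count (fun p => p.2 == x) es.
Proof.
move=> sp1 sp2 dis nes ues cr.
have [sq1 l1 c1] := sp1; have [sq2 l2 c2] := sp2.
have N x : x \in S1 -> x \in S2 -> False.
  by move=> x1; rewrite (disjointFr dis x1).
pose r x y := [|| F1 x y, F2 x y, (x, y) \in es | (y, x) \in es].
have rsym : symmetric r.
  by move=> x y; rewrite /r (adj_sym F1) (adj_sym F2) (orbC (_ \in es)).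
have rirr : irreflexive r.
  move=> x; rewrite /r !adj_irr orbb /=; apply/negP => /cr/and3P[x1 x2 _].
  exact: N x1 x2.
exists (SGraph rsym rirr); first split.
- move=> x y /or4P[/sq1//|/sq2//|/cr/and3P[]//|/cr/and3P[_ _]].
  by rewrite adj_sym.
- move=> x y /or4P[/l1|/l2|/cr/and3P[+ _ _]|/cr/and3P[_ + _]];
  by rewrite inE => ->; rewrite ?orbT.
- set F := SGraph rsym rirr.
  have csym : connect_sym F by apply: sym_connect_sym; apply: adj_sym.
  have s1 : subrel (connect F1) (connect F).
    by apply: connect_sub => x y xy; apply: connect1; rewrite /= /r xy.
  have s2 : subrel (connect F2) (connect F).
    by apply: connect_sub => x y xy; apply: connect1; rewrite /= /r xy orbT.
  have c12 x y : x \in S1 -> y \in S2 -> connect F x y.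
    move=> x1 y2; have [p pes] : exists p, p \in es.
      by case: (es) nes => // p es' _; exists p; rewrite mem_head.
    have /and3P[p1 p2 _] := cr p pes.
    apply: connect_trans (s1 _ _ (c1 _ _ x1 p1)) _.
    apply: connect_trans (s2 _ _ (c2 _ _ p2 y2)).
    by apply: connect1; rewrite /= /r -surjective_pairing pes !orbT.
  move=> x y; rewrite !inE => /orP[x1|x2] /orP[y1|y2].
  + exact: s1 (c1 _ _ x1 y1).
  + exact: c12.
  + by rewrite csym; apply: c12.
  + exact: s2 (c2 _ _ x2 y2).
- move=> x; rewrite -card_pairs_fst // -card_pairs_snd // /degree.
  pose D1 := [set y | F1 x y]; pose D2 := [set y | F2 x y].
  pose E1 := [set y | (x, y) \in es]; pose E2 := [set y | (y, x) \in es].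
  have -> : [set y | r x y] = D1 :|: D2 :|: E1 :|: E2.
    by apply/setP => y; rewrite !inE /r !orbA.
  have disj (A B : {set V}) :
      (forall y, y \in A -> y \in B -> False) -> #|A :|: B| = #|A| + #|B|.
    move=> AB; rewrite cardsU; suff -> : A :&: B = set0 by rewrite cards0 subn0.
    by apply/setP=> y; rewrite !inE; apply/andP => -[/AB].
  rewrite !disj //.
  + by move=> y; rewrite !inE => /l1 x1 /l2; apply: N.
  + move=> y; rewrite !inE => xy /cr/and3P[/= x1 y2 _].
    case/orP: xy => [/(spans_r sp1) y1|/l2 x2]; first exact: N y1 y2.
    exact: N x1 x2.
  + move=> y; rewrite !inE => xy /cr/and3P[/= y1 x2 _].
    case/orP: xy => [/orP[/l1 x1|/(spans_r sp2) y2]|/cr/and3P[/= x1 _ _]];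
    by [apply: (N x)|apply: (N y)].
Qed.

Definition aug F a b x := degree F x + (x == a) + (x == b).

(* A connected graph on [S] with a dangling half-edge at [a] and one at [b],
   both counted in the degrees, which are even and bounded by [f]. *)
Definition segment f S a b : Prop :=
  [/\ a \in S, b \in S & exists2 F, spans S F &
    {in S, forall x, ~~ odd (aug F a b x) /\ aug F a b x <= f x}].

Lemma segment_rev f S a b : segment f S a b -> segment f S b a.
Proof.
case=> aS bS [F sF aF]; split=> //; exists F => // x /aF.
by rewrite /aug addnAC.
Qed.

Lemma segment_cap f g S a b :
  {in S, forall x, f x <= g x} -> segment f S a b -> segment g S a b.
Proof.
move=> fg [aS bS [F sF aF]]; split=> //; exists F => // x xS.
by have [-> /leq_trans->] := aF x xS; rewrite ?fg.
Qed.

Lemma segment1 f a : 2 <= f a -> segment f [set a] a a.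
Proof.
have r0 : symmetric (fun _ _ : V => false) by [].
move=> fa; split; rewrite ?set11 //; exists (SGraph r0 (fun=> erefl)).
  by split=> // x y; rewrite !inE => /eqP-> /eqP->; apply: connect0.
move=> x /set1P->; rewrite /aug /degree !eqxx.
have -> : [set y : V | false] = set0 by apply/setP=> y; rewrite !inE.
by rewrite cards0.
Qed.

Lemma degree_out S F x : spans S F -> x \notin S -> degree F x = 0.
Proof.
case=> _ sF _ xS; apply/eqP; rewrite cards_eq0; apply/eqP/setP=> y.
by rewrite !inE; apply: contraNF xS => /sF.
Qed.

(** The half-edges at [b1] and [a2] merge into an edge, so the augmented degrees do not change. *)
Lemma segment_cat f S1 S2 a1 b1 a2 b2 :
    segment f S1 a1 b1 -> segment f S2 a2 b2 -> [disjoint S1 & S2] ->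
    square G b1 a2 ->
  segment f (S1 :|: S2) a1 b2.
Proof.
case=> aS1 bS1 [F1 sF1 aF1] [aS2 bS2 [F2 sF2 aF2]] dis sq.
have [] := glue sF1 sF2 dis (es := [:: (b1, a2)]) => //.
  by move=> p; rewrite inE => /eqP->; rewrite bS1 aS2.
move=> F sF dF; split; rewrite ?inE ?aS1 ?bS2 ?orbT //; exists F => // x.
rewrite /aug dF /= !addn0 inE => /orP[x1|x2].
- have x2 : x \notin S2 by rewrite (disjointFr dis x1).
  have [] := aF1 x x1; rewrite /aug (degree_out sF2 x2).
  have -> : (x == b2) = false by apply: contraNF x2 => /eqP->.
  have -> : (a2 == x) = false by apply: contraNF x2 => /eqP<-.
  rewrite (eq_sym b1); clear; lia.
- have x1 : x \notin S1 by rewrite (disjointFl dis x2).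
  have [] := aF2 x x2; rewrite /aug (degree_out sF1 x1).
  have -> : (x == a1) = false by apply: contraNF x1 => /eqP->.
  have -> : (b1 == x) = false by apply: contraNF x1 => /eqP<-.
  rewrite (eq_sym a2); clear; lia.
Qed.

(* Besides the edge that joins the two segments, the dangling half-edge at [b2]
   becomes an edge to [v], and a new half-edge is left dangling at [v]. *)
Lemma segment_cat_hook f g S1 S2 a1 b1 a2 b2 v :
    segment f S1 a1 b1 -> segment f S2 a2 b2 -> [disjoint S1 & S2] ->
    square G b1 a2 -> square G v b2 -> v \in S1 -> (v, b2) != (b1, a2) ->
    (forall x, f x + (x == v).*2 <= g x) ->
  segment g (S1 :|: S2) a1 v.
Proof.
case=> aS1 bS1 [F1 sF1 aF1] [aS2 bS2 [F2 sF2 aF2]] dis sq sqv vS1 neq fg.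
have [] := glue sF1 sF2 dis (es := [:: (v, b2); (b1, a2)]) => //.
- by rewrite /= inE neq.
- by move=> p; rewrite !inE => /orP[]/eqP->; rewrite ?bS1 ?vS1 ?aS2 ?bS2.
move=> F sF dF; split; rewrite ?inE ?aS1 ?vS1 //; exists F => // x.
rewrite /aug dF /= !addn0 inE => /orP[x1|x2].
- have x2 : x \notin S2 by rewrite (disjointFr dis x1).
  have [] := aF1 x x1; rewrite /aug (degree_out sF2 x2).
  have -> : (b2 == x) = false by apply: contraNF x2 => /eqP<-.
  have -> : (a2 == x) = false by apply: contraNF x2 => /eqP<-.
  have := fg x; rewrite (eq_sym b1) (eq_sym v); clear; lia.
- have x1 : x \notin S1 by rewrite (disjointFl dis x2).
  have [] := aF2 x x2; rewrite /aug (degree_out sF1 x1).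
  have -> : (x == a1) = false by apply: contraNF x1 => /eqP->.
  have -> : (b1 == x) = false by apply: contraNF x1 => /eqP<-.
  have := fg x; rewrite (eq_sym v).
  have -> : (x == v) = false by apply: contraNF x1 => /eqP->.
  rewrite (eq_sym a2) (eq_sym b2); clear; lia.
Qed.

(** Both pairs of half-edges merge into edges, so none is left dangling and the degrees themselves
    are even. The two edges have to differ because the graph is simple. *)
Lemma segment_close f S1 S2 a1 b1 a2 b2 :
    segment f S1 a1 b1 -> segment f S2 a2 b2 -> [disjoint S1 & S2] ->
    square G b1 a2 -> square G a1 b2 -> (a1, b2) != (b1, a2) ->
  exists2 F, spans (S1 :|: S2) F &
    {in S1 :|: S2, forall x, ~~ odd (degree F x) /\ degree F x <= f x}.
Proof.
case=> aS1 bS1 [F1 sF1 aF1] [aS2 bS2 [F2 sF2 aF2]] dis sq sqv neq.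
have [] := glue sF1 sF2 dis (es := [:: (a1, b2); (b1, a2)]) => //.
- by rewrite /= inE neq.
- by move=> p; rewrite !inE => /orP[]/eqP->; rewrite ?aS1 ?bS1 ?aS2 ?bS2.
move=> F sF dF; exists F => // x; rewrite dF /= !addn0 inE => /orP[x1|x2].
- have x2 : x \notin S2 by rewrite (disjointFr dis x1).
  have [] := aF1 x x1; rewrite /aug (degree_out sF2 x2).
  have -> : (b2 == x) = false by apply: contraNF x2 => /eqP<-.
  have -> : (a2 == x) = false by apply: contraNF x2 => /eqP<-.
  rewrite (eq_sym b1) (eq_sym a1); clear; lia.
- have x1 : x \notin S1 by rewrite (disjointFl dis x2).
  have [] := aF2 x x2; rewrite /aug (degree_out sF1 x1).
  have -> : (a1 == x) = false by apply: contraNF x1 => /eqP<-.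
  have -> : (b1 == x) = false by apply: contraNF x1 => /eqP<-.
  rewrite (eq_sym b2) (eq_sym a2); clear; lia.
Qed.
End Segments.

Lemma disjoint_setUl (T : finType) (A B C : {set T}) :
  [disjoint A :|: B & C] = [disjoint A & C] && [disjoint B & C].
Proof. by rewrite -!setI_eq0 setIUl setU_eq0. Qed.

Lemma disjoint_setUr (T : finType) (A B C : {set T}) :
  [disjoint A & B :|: C] = [disjoint A & B] && [disjoint A & C].
Proof. by rewrite ![[disjoint A & _]]disjoint_sym disjoint_setUl. Qed.

(** * Attaching several segments to one vertex *)

Section Hub.
Variables (V : finType) (G : sgraph V) (s : nat).
Implicit Types (S : {set V}) (u : {set V} * V * V) (us : seq ({set V} * V * V)).

Lemma square1 x y : G x y -> square G x y.
Proof.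
move=> xy; apply/andP; split; first by apply: contraTneq xy => ->; rewrite adj_irr.
apply/dist_leP; exists 1 => //; apply/existsP; exists [tuple y].
by rewrite /= xy eqxx.
Qed.

Lemma square2 x y z : x != y -> G z x -> G z y -> square G x y.
Proof.
move=> nxy zx zy; apply/andP; split=> //; apply/dist_leP; exists 2 => //.
by apply/existsP; exists [tuple z; y]; rewrite /= adj_sym zx zy eqxx.
Qed.

Lemma adj_neq x y : G x y -> x != y.
Proof. by apply: contraTneq => ->; rewrite adj_irr. Qed.

Definition support us : {set V} := \bigcup_(u <- us) u.1.1.

Fixpoint disjoint_segments us : bool :=
  if us is u :: us' then [disjoint u.1.1 & support us'] && disjoint_segments us'
  else true.

(** A triple holds the vertex set of a segment, its entry and its exit. Exits are neighbours of [v]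
    in [G] itself, so that any two distinct ones are adjacent in the square. *)
Definition attachable v us : Prop :=
  {in us, forall u, [/\ segment G (fun=> 2 * s) u.1.1 u.1.2 u.2,
    v \notin u.1.1, square G v u.1.2 & G v u.2]}.

Lemma support_cons u us : support (u :: us) = u.1.1 :|: support us.
Proof. by rewrite /support big_cons. Qed.

Lemma supportP us x : reflect (exists2 u, u \in us & x \in u.1.1) (x \in support us).
Proof.
elim: us => [|u us IH].
  by rewrite /support big_nil inE; constructor => -[].
rewrite support_cons inE; apply: (iffP orP) => [[xu|/IH[w ws xw]]|[w]].
- by exists u; rewrite ?mem_head.
- by exists w; rewrite // inE ws orbT.
- by rewrite inE => /orP[/eqP->|ws xw]; [left|right; apply/IH; exists w].
Qed.

(** The bound at [v] is kept apart, as it grows while segments are attached. *)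
Definition cap (v : V) k x : nat := if x == v then k else 2 * s.

Lemma attachable_cap v us u k : attachable v us -> u \in us ->
  segment G (cap v k) u.1.1 u.1.2 u.2.
Proof.
move=> au /au[su vu _ _]; apply: segment_cap su => x xu.
by rewrite /cap; case: eqP => // xv; rewrite -xv xu in vu.
Qed.

Lemma disjoint_hub v us u S : attachable v us -> u \in us ->
  [disjoint u.1.1 & S] -> [disjoint v |: S & u.1.1].
Proof.
move=> au /au[_ vu _ _]; rewrite disjoint_sym => d.
rewrite disjoint_sym disjoints_subset; apply/subsetP => x xu.
rewrite !inE negb_or (disjointFl d xu) andbT.
by apply: contraNneq vu => <-.
Qed.

Lemma square_exits v us u d : attachable v us -> u \in us ->
  G v d -> d \notin u.1.1 -> square G d u.2.
Proof.
move=> au /au[[_ bu _] _ _ vb] vd du; apply: square2 vd vb.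
by apply: contraNneq du => ->.
Qed.

Lemma exit_out v us u d : attachable v us -> [disjoint u.1.1 & support us] ->
  d \in map snd us -> d \notin u.1.1 /\ G v d.
Proof.
move=> au dis /mapP[w wus ->]; have [[_ bw _] _ _ vb] := au w wus; split=> //.
by rewrite (disjointFl dis) //; apply/supportP; exists w.
Qed.

(** Every entry is joined to [v] and the exits are paired up, except for a spare one; with the
    half-edge at [v] this gives the bound [(size us).+1] there. *)
Lemma hub_odd v us : attachable v us -> disjoint_segments us -> odd (size us) ->
  exists2 d, d \in map snd us
    & segment G (cap v (size us).+1) (v |: support us) d v.
Proof.
have [n] := ubnP (size us); elim: n us => // n IH [|u [|w us]] //= ltn au.
  move=> _ _; exists u.2; rewrite ?mem_head //.
  have [_ vu va _] := au u (mem_head _ _).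
  rewrite support_cons /support big_nil setU0 setUC.
  apply: segment_cat (segment_rev (attachable_cap _ au (mem_head _ _))) _ _ _.
  - by apply: segment1; rewrite /cap eqxx.
  - by rewrite disjoint_sym disjoints1.
  - by rewrite adj_sym.
rewrite support_cons => /and3P[]; rewrite support_cons => du dw dus; rewrite negbK => osz.
have aus : attachable v us by move=> x xus; apply: au; rewrite !inE xus !orbT.
have [|d dus' O] := IH us _ aus dus osz; first by move: ltn; clear; lia.
have uin : u \in [:: u, w & us] by rewrite mem_head.
have win : w \in [:: u, w & us] by rewrite !inE eqxx orbT.
have du' : [disjoint u.1.1 & support us].
  by apply: disjointWr du; apply: subsetUr.
have [ndu vd] := exit_out aus du' dus'.
exists w.2; first by rewrite !inE eqxx orbT.
have [_ vu vau vbu] := au u uin; have [_ vw vaw vbw] := au w win.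
(* The exit of [u] is joined to the spare exit [d], and [v] carries both half-edges; one of them
   receives the entry of [w], whose exit becomes the spare one. *)
have C : segment G (cap v (size us).+3) ((v |: support us) :|: u.1.1) v v.
  have su := segment_rev (attachable_cap (size us).+1 au uin).
  apply: segment_cat_hook (segment_rev O) su _ _ vau _ _ _.
  - exact: disjoint_hub au uin du'.
  - exact: square_exits au uin vd ndu.
  - by rewrite setU11.
  - by rewrite xpair_eqE (negPf (adj_neq vd)).
  - by move=> x; rewrite /cap; case: eqP => _; clear; lia.
have -> : v |: (u.1.1 :|: support (w :: us)) =
          w.1.1 :|: ((v |: support us) :|: u.1.1).
  apply/setP=> x; rewrite support_cons !inE.
  by case: (x == v); case: (x \in u.1.1); case: (x \in w.1.1); rewrite ?orbT ?orbF.
apply: segment_cat (segment_rev (attachable_cap _ au win)) C _ _.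
- move: du dw; rewrite disjoint_setUr => /andP[uw _] wU.
  by rewrite !disjoint_setUr wU disjoint_sym disjoints1 vw disjoint_sym.
- by rewrite adj_sym.
Qed.

(** For an even number of segments, one is tied to [v] by both ends. The bound at [v] is then the
    size plus two, which for an even size below [2 * s] is at most [2 * s]. *)
Lemma hub v us : 0 < size us < 2 * s -> attachable v us -> disjoint_segments us ->
  exists2 d, d \in map snd us & segment G (fun=> 2 * s) (v |: support us) d v.
Proof.
move=> /andP[us0 ltus] au dus.
have [osz|] := boolP (odd (size us)).
  have [d dus' O] := hub_odd au dus osz; exists d => //.
  by apply: segment_cap O => x _; rewrite /cap; case: eqP.
case: us us0 ltus au dus => // u us _ /= ltn au; rewrite negbK => /andP[du dus] osz.
have aus : attachable v us by move=> x xus; apply: au; rewrite !inE xus !orbT.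
have uin : u \in u :: us by rewrite mem_head.
have [d dus' O] := hub_odd aus dus osz.
have [ndu vd] := exit_out aus du dus'.
have [[au1 _ _] vu vau vbu] := au u uin.
have dis := disjoint_hub au uin du.
have -> : v |: support (u :: us) = (v |: support us) :|: u.1.1.
  by rewrite support_cons setUCA setUC.
(* If entry and exit coincide, the two edges to [v] would be the same. But then the entry is
   adjacent in the square to the spare exit [d] and can be joined to it instead of [v]. *)
have [ab|nab] := eqVneq u.1.2 u.2.
  exists u.2; first by rewrite inE eqxx.
  have su := attachable_cap (size us).+1 au uin.
  have O' : segment G (cap v (size us).+1) (v |: support us :|: u.1.1) v u.2.
    apply: segment_cat (segment_rev O) su dis _.
    by rewrite ab; apply: square_exits au uin vd ndu.
  apply: segment_rev; apply: segment_cap O' => x _; rewrite /cap.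
  by case: eqP => // _; apply: ltnW.
exists d; first by rewrite inE dus' orbT.
have su := attachable_cap (size us).+1 au uin.
apply: segment_cat_hook O su dis vau (square1 vbu) _ _ _.
- by rewrite setU11.
- by rewrite xpair_eqE eqxx eq_sym.
- by move=> x; rewrite /cap; case: eqP => _; move: ltn osz; clear; lia.
Qed.
End Hub.

(** * Concatenating segments along directed paths *)

Section Chains.
Variables (V : finType) (G : sgraph V) (f : V -> nat) (v0 : V).
Variables (N : {set V}) (S : V -> {set V}) (a b : V -> V).
Hypothesis segN : {in N, forall c, segment G f (S c) (a c) (b c)}.
Hypothesis disN : {in N &, forall c c', c != c' -> [disjoint S c & S c']}.

Definition follows : rel V := fun c c' => (c != c') && square G (b c) (a c').

(** [v0] is only a default value for the empty list. *)
Definition chain (p : seq V) : {set V} * V * V :=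
  (\bigcup_(c <- p) S c, a (head v0 p), b (last v0 p)).

Lemma disjoint_chain c p : c \in N -> {subset p <= N} -> c \notin p ->
  [disjoint S c & \bigcup_(c' <- p) S c'].
Proof.
move=> cN; elim: p => [|c' p IH] pN.
  by rewrite big_nil -setI_eq0 setI0.
rewrite inE negb_or => /andP[ncc' cp]; rewrite big_cons disjoint_setUr.
apply/andP; split; first by apply: disN => //; apply: pN; rewrite mem_head.
apply: IH => // x xp.
by apply: pN; rewrite inE xp orbT.
Qed.

Lemma disjoint_chains p q : {subset p <= N} -> {subset q <= N} -> ~~ has (mem p) q ->
  [disjoint \bigcup_(c <- p) S c & \bigcup_(c <- q) S c].
Proof.
move=> pN qN; elim: p pN => [|c p IH] pN.
  by rewrite big_nil -setI_eq0 set0I.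
rewrite has_sym /= negb_or => /andP[cq pq]; rewrite big_cons disjoint_setUl.
rewrite disjoint_chain ?pN ?mem_head // IH ?(has_sym p) // 1?has_sym //.
by move=> x xp; apply: pN; rewrite inE xp orbT.
Qed.

Lemma chain_segment p : nepath follows p -> uniq p -> {subset p <= N} ->
  segment G f (chain p).1.1 (chain p).1.2 (chain p).2.
Proof.
case: p => // x p; elim: p x => [|y p IH] x /= pp up pN.
  by rewrite /chain big_seq1 /=; apply: segN; rewrite pN ?mem_head.
case/andP: pp => /andP[_ xy] pp; case/andP: up => xp up.
have xN : x \in N by rewrite pN ?mem_head.
have ypN : {subset y :: p <= N} by move=> z zp; apply: pN; rewrite inE zp orbT.
rewrite /chain big_cons; apply: segment_cat (segN xN) (IH y pp up ypN) _ xy.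
exact: disjoint_chain.
Qed.

Lemma support_chains Q :
  support (map chain Q) = \bigcup_(c <- flatten Q) S c.
Proof.
elim: Q => [|p Q IH] /=; first by rewrite /support !big_nil.
by rewrite support_cons IH big_cat.
Qed.

Lemma disjoint_segments_chains Q : uniq (flatten Q) -> {subset flatten Q <= N} ->
  disjoint_segments (map chain Q).
Proof.
elim: Q => //= p Q IH; rewrite cat_uniq => /and3P[up pq uQ] sN.
rewrite IH // ?andbT; last by move=> x xQ; apply: sN; rewrite mem_cat xQ orbT.
rewrite support_chains disjoint_chains // => x xQ; apply: sN;
by rewrite mem_cat xQ ?orbT.
Qed.
End Chains.

(** * Induced subdivided stars *)

Section Star.
Variables (V : finType) (G : sgraph V).

Lemma free_embedding (W : finType) (H : sgraph W) (g : W -> V) :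
  injective g -> (forall x y, G (g x) (g y) = H x y) -> ~ free H G.
Proof.
move=> ginj gadj /(_ [set g x | x : W]); apply.
have gA x : g x \in [set g x | x : W] by apply: imset_f.
pose h x : {y | y \in [set g x | x : W]} := Sub (g x) (gA x).
have hinj : injective h by move=> x y /(congr1 val) /ginj.
have hsurj y : exists x, h x == y.
  case: y => y yA; have /imsetP[x _ yx] := yA.
  by exists x; rewrite -val_eqE /= yx.
have hK : cancel (fun y => xchoose (hsurj y)) h.
  by move=> y; apply/eqP; apply: (xchooseP (hsurj y)).
exists (fun y => xchoose (hsurj y)).
  by exists h => // x; apply: hinj; rewrite hK.
move=> x y; rewrite -gadj.
exact: (congr2 (fun u w : {y | y \in _} => G (val u) (val w)) (hK x) (hK y)).
Qed.

Definition induced_legs v (I : {set V}) (d : V -> V) : Prop :=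
  {in I, forall c, [/\ G v c, G c (d c), d c != v & ~~ G v (d c)]} /\
  {in I &, forall c c', c != c' ->
    [/\ ~~ G c c', ~~ G c (d c') & ~~ G (d c) (d c')]}.

Lemma edge_bipartite1 n (e : {set ('I_1 + 'I_n)%type}) :
  e \in edges (complete_bipartite 1 n) -> exists j, e = [set inl ord0; inr j].
Proof.
case/imsetP=> -[[i|j] [i'|j']]; rewrite inE //= => _ ->.
  by exists j'; rewrite (ord1 i).
by exists j; rewrite (ord1 i') setUC.
Qed.

(** With [n] legs, the leaves of the star can be sent to vertices [d c] and the subdivision vertices
    to the [c], which gives the forbidden induced subgraph. *)
Lemma free_legs n v (I : {set V}) d :
    free (subdivision (complete_bipartite 1 n)) G -> induced_legs v I d ->
  #|I| < n.
Proof.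
move=> fG [legI indI]; rewrite ltnNge; apply/negP => nI.
pose c (j : 'I_n) : V := enum_val (widen_ord nI j).
have cI j : c j \in I by apply: enum_valP.
have cinj : injective c.
  by move=> i j /enum_val_inj /(congr1 val) ij; apply: val_inj.
pose g (x : subdivision_vertex (complete_bipartite 1 n)) : V :=
  match x with
  | inl (inl _) => v
  | inl (inr j) => d (c j)
  (* The default [v] is never taken, as every edge has an end [inr j]. *)
  | inr e => if [pick j | inr j \in val e] is Some j then c j else v
  end.
have gE (e : {e | e \in edges (complete_bipartite 1 n)}) :
    exists j, val e = [set inl ord0; inr j] /\ g (inr e) = c j.
  case: e => e eE; have [j ej] := edge_bipartite1 eE; exists j; split=> //=.
  case: pickP => [k|/(_ j)]; rewrite ej !inE ?eqxx //=.
  by move=> /eqP[->].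
have vc j : G v (c j) by have [] := legI _ (cI j).
have cd j : G (c j) (d (c j)) by have [] := legI _ (cI j).
have dv j : (d (c j) == v) = false by have [_ _ /negPf] := legI _ (cI j).
have vd j : G v (d (c j)) = false by have [_ _ _ /negPf] := legI _ (cI j).
have ncc i j : G (c i) (c j) = false.
  have [->|nij] := eqVneq i j; first by rewrite adj_irr.
  have [] := indI _ _ (cI i) (cI j); first by rewrite (inj_eq cinj).
  by move/negPf.
have ndd i j : G (d (c i)) (d (c j)) = false.
  have [->|nij] := eqVneq i j; first by rewrite adj_irr.
  have [] := indI _ _ (cI i) (cI j); first by rewrite (inj_eq cinj).
  by move=> _ _ /negPf.
have ncd i j : G (c i) (d (c j)) = (i == j).
  have [->|nij] := eqVneq i j; first by rewrite cd.
  have [] := indI _ _ (cI i) (cI j); first by rewrite (inj_eq cinj).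
  by move=> _ /negPf.
(* The vertices [d (c j)] are told apart by their neighbours among the [c i]. *)
have dinj : injective (fun j => d (c j)).
  by move=> i j /= dij; apply/eqP; rewrite -ncd -dij cd.
have ndc i j : G (d (c i)) (c j) = (i == j) by rewrite adj_sym ncd eq_sym.
have cv j : G (c j) v by rewrite adj_sym.
have dvs j : G (d (c j)) v = false by rewrite adj_sym.
apply: (@free_embedding _ (subdivision (complete_bipartite 1 n)) g) fG.
- move=> [[i|j]|e] [[i'|j']|e'] //.
  + by rewrite (ord1 i) (ord1 i').
  + by move=> /= /eqP; rewrite eq_sym dv.
  + by have [j [_ ->]] := gE e' => /= vcj; have := vc j; rewrite -vcj adj_irr.
  + by move=> /= /eqP; rewrite dv.
  + by move=> /= /dinj ->.
  + by have [k [_ ->]] := gE e' => /= dck; have := vc k; rewrite -dck vd.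
  + by have [j [_ ->]] := gE e => /= vcj; have := vc j; rewrite vcj adj_irr.
  + by have [k [_ ->]] := gE e => /= dck; have := vc k; rewrite dck vd.
  + have [i [ei ->]] := gE e; have [j [ej ->]] := gE e' => /cinj ij.
    by congr inr; apply: val_inj; rewrite ei ej ij.
- move=> [[i|j]|e] [[i'|j']|e'].
  + by rewrite /= adj_irr.
  + by rewrite /= vd.
  + by have [j [ej ->]] := gE e'; rewrite /= ej vc (ord1 i) !inE eqxx.
  + by rewrite /= dvs.
  + by rewrite /= ndd.
  + by have [k [ej ->]] := gE e'; rewrite /= ej ndc !inE.
  + by have [j [ej ->]] := gE e; rewrite /= ej cv (ord1 i') !inE eqxx.
  + by have [k [ej ->]] := gE e; rewrite /= ej ncd !inE eq_sym.
  + by have [i [ei ->]] := gE e; have [j [ej ->]] := gE e'; rewrite /= ncc.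
Qed.
End Star.

(** * Distance functions and an order inside components *)

Lemma layering (T : finType) (e : rel T) x0 : exists h : T -> nat,
  [/\ h x0 = 0,
    forall x y, connect e x0 x -> e x y -> h y <= (h x).+1
  & forall x, connect e x0 x -> x != x0 ->
      exists2 y, e y x & connect e x0 y /\ h x = (h y).+1].
Proof.
pose reach n x := [exists p : n.-tuple T, path e x0 p && (last x0 p == x)].
have reachP n x : reflect (exists p, [/\ size p = n, path e x0 p & last x0 p = x])
    (reach n x).
  apply: (iffP existsP) => [[p /andP[pp /eqP lp]]|[p [sp pp lp]]].
    by exists p; rewrite size_tuple.
  by move/eqP: sp => sp; exists (Tuple sp); rewrite /= pp lp eqxx.
(* [h x] is the distance from [x0], and arbitrary where [x] cannot be reached. *)
have exh x : exists n, connect e x0 x -> reach n x /\ forall m, reach m x -> n <= m.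
  case: (boolP (connect e x0 x)) => [/connectP[p pp lp]|_]; last by exists 0.
  have ex : exists n, reach n x by exists (size p); apply/reachP; exists p.
  by case: (ex_minnP ex) => n rn mn; exists n.
have [h hP] := fin_all_exists exh.
have reachS n x y : reach n x -> e x y -> reach n.+1 y.
  case/reachP=> p [<- pp <-] xy; apply/reachP; exists (rcons p y).
  by rewrite size_rcons rcons_path last_rcons pp.
have reach_connect n x : reach n x -> connect e x0 x.
  by case/reachP=> p [_ pp <-]; apply/connectP; exists p.
exists h; split.
- apply/eqP; rewrite -leqn0; have [_ ->] // := hP x0 (connect0 _ _).
  by apply/reachP; exists [::].
- move=> x y cx xy; have [_ -> //] := hP y (connect_trans cx (connect1 xy)).
  by apply: reachS xy; have [] := hP x cx.
- move=> x cx nx; have [/reachP[p [sp pp lp]] minx] := hP x cx.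
  case/lastP: p sp pp lp => [_ _ /= x0x|p z]; first by rewrite x0x eqxx in nx.
  rewrite size_rcons rcons_path last_rcons => sp /andP[pp ezx] zx.
  rewrite zx in ezx; exists (last x0 p) => //.
  have rl : reach (size p) (last x0 p) by apply/reachP; exists p.
  have cl := reach_connect _ _ rl; split=> //.
  have [rm minl] := hP _ cl; apply/eqP; rewrite eqn_leq minx ?(reachS _ _ _ rm) //.
  by rewrite -sp ltnS minl.
Qed.

(* [key] is the distance to the root of the component, shifted so that [mate]
   comes strictly before the other neighbours of the root. *)
Lemma component_order (T : finType) (e : rel T) : symmetric e ->
  exists (mate : T -> T) (key : T -> nat),
  [/\ forall x y, e (root e x) y -> e (root e x) (mate (root e x)),
    forall x, x != root e x -> exists2 y, e y x & key y < key x
  & forall x, x != root e x -> x != mate (root e x) ->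
      key (mate (root e x)) < key x].
Proof.
move=> e_sym; have csym := sym_connect_sym e_sym.
(* A vertex without neighbours is its own mate. *)
pose mate t := odflt t [pick v | e t v].
have mateP t v : e t v -> e t (mate t).
  by rewrite /mate; case: pickP => // none; rewrite none.
have mate_neq t : mate t != t -> e t (mate t).
  by rewrite /mate; case: pickP => //= _; rewrite eqxx.
have exd t : exists dl : T -> nat, forall x, connect e t x -> x != t ->
    exists2 y, e y x & connect e t y /\ dl x = (dl y).+1.
  by have [dl [_ _ dlP]] := layering e t; exists dl.
have [dl dlP] := fin_all_exists exd.
pose key x := if x == root e x then 0 else if x == mate (root e x) then 1
  else (dl (root e x) x).+1.
have rootC t y : root e t = t -> connect e t y -> root e y = t.
  by move=> rt cty; apply/esym; rewrite -{1}rt; apply/eqP; rewrite root_connect.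
have mate_root t : root e t = t -> root e (mate t) = t.
  move=> rt; apply: rootC => //; rewrite /mate; case: pickP => //= v ev.
  exact: connect1.
have keyS x : x != root e x -> x != mate (root e x) ->
    exists2 y, e y x & (root e y = root e x) /\
      key x = (dl (root e x) y).+2.
  move=> nx mx; have [|y yx [cy dy]] := dlP (root e x) x _ nx.
    by rewrite csym connect_root.
  exists y => //; split; first by apply: rootC cy; apply: root_root.
  by rewrite /key (negPf nx) (negPf mx) dy.
exists mate, key; split=> [x y|x nx|x nx mx]; first exact: mateP.
(* The mate is preceded by the root; any other vertex by a neighbour [y] closer to the root, whose
   key is at most its distance plus one. *)
- have [xm|mx] := eqVneq x (mate (root e x)).
    exists (root e x); last by rewrite /key root_root // eqxx (negPf nx) -xm eqxx.
    by rewrite [X in e _ X]xm mate_neq // -xm.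
  have [y yx [ry ->]] := keyS x nx mx; exists y => //.
  by rewrite /key ry; case: ifP => // _; case: ifP.
- have [y yx [ry ->]] := keyS x nx mx.
  by rewrite /key mate_root ?root_root //; case: ifP; rewrite ?eqxx.
Qed.

(** * Branches below one vertex *)

Section Branches.
Variables (V : finType) (G : sgraph V) (s : nat).
Implicit Types (K I : {set V}) (S : V -> {set V}).

Local Notation seg := (segment G (fun=> 2 * s)).

(* [d c = c] encodes a child [c] that has no child itself. *)
Definition leg v (d : V -> V) c : bool :=
  G v c && ((d c == c) || [&& G c (d c), d c != v & ~~ G v (d c)]).

Lemma square_leg v d c : leg v d c -> square G v (d c).
Proof.
case/andP=> vc /orP[/eqP->|/and3P[cd dv _]]; first exact: square1.
by apply: (square2 (z := c)); rewrite // 1?eq_sym // adj_sym.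
Qed.

(** Each excluded edge would give a path of length at most two from [c] to [d c'], hence an arc; so
    would [d c' = c'], by way of [v]. *)
Lemma legs_apart v d c c' : leg v d c -> leg v d c' -> c != c' ->
    ~~ follows G d id c c' ->
  [/\ d c' != c', ~~ G c c', ~~ G c (d c') & (d c != c) ==> ~~ G (d c) (d c')].
Proof.
rewrite /follows => /andP[vc lc] /andP[vc' lc'] ncc'; rewrite ncc' /= => nsq.
have dc' : d c' != c'.
  by apply: contraNneq nsq => ->; apply: square2 ncc' vc vc'.
move: lc'; rewrite (negPf dc') /= => /and3P[cd' _ vd'].
have ncd' : c != d c' by apply: contraNneq vd' => <-.
split=> //.
- apply: contraNN nsq => cc'; apply: (square2 (z := c')) => //.
  by rewrite adj_sym.
- by apply: contraNN nsq => cc'; apply: square1.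
- apply/implyP => dc; move: lc; rewrite (negPf dc) /= => /and3P[cd _ _].
  apply: contraNN nsq => dd'; apply: (square2 (z := d c)) => //.
  by rewrite adj_sym.
Qed.

(** Given a second element, each [c] is the target of a missing arc, which rules out [d c = c]; a
    single element could be childless. *)
Lemma independent_legs v K I d : {in K, forall c, leg v d c} -> I \subset K ->
  independent (follows G d id) I -> 1 < #|I| ->
  {in I, forall c, d c != c} /\ induced_legs G v I d.
Proof.
move=> legK /subsetP IK indI I1.
have apart c c' : c \in I -> c' \in I -> c != c' -> 
    [/\ d c' != c', ~~ G c c', ~~ G c (d c') & (d c != c) ==> ~~ G (d c) (d c')].
  by move=> cI c'I ncc'; apply: (legs_apart (legK _ (IK _ cI)) (legK _ (IK _ c'I)));
    rewrite ?indI.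
have dI : {in I, forall c, d c != c}.
  move=> c cI; have [c' c'I ncc'] : exists2 c', c' \in I & c' != c.
    have /card_gt0P[c'] : 0 < #|I :\ c| by move: I1; rewrite (cardsD1 c) cI.
    by rewrite !inE => /andP[nc' c'I]; exists c'.
  by have [] := apart _ _ c'I cI ncc'.
split=> //; split=> [c cI|c c' cI c'I ncc'].
  have /andP[vc] := legK _ (IK _ cI); rewrite (negPf (dI _ cI)) /=.
  by case/and3P.
have [_ ? ? /implyP] := apart _ _ cI c'I ncc'.
by move/(_ (dI _ cI)).
Qed.

Hypothesis s0 : 0 < s.
Hypothesis freeG : free (subdivision (complete_bipartite 1 (2 * s + 1))) G.

Lemma independence_star v K I d : {in K, forall c, leg v d c} -> I \subset K ->
  independent (follows G d id) I -> #|I| <= 2 * s.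
Proof.
move=> legK IK indI; have [I1|I1] := leqP #|I| 1.
  by apply: leq_trans I1 _; rewrite muln_gt0.
have [_ legI] := independent_legs legK IK indI I1.
by have := free_legs freeG legI; rewrite addn1.
Qed.

(** The path from [v] through [u] to [t] is one more leg of the star, which lowers the bound by
    one. *)
Lemma independence_upleg v K I d u t : {in K, forall c, leg v d c} -> I \subset K ->
    G v u -> G u t -> t != v -> ~~ G v t ->
    {in K, forall c, [/\ ~~ G u c, ~~ G u (d c), ~~ G t c & ~~ G t (d c)]} ->
  independent (follows G d id) I -> #|I| < 2 * s.
Proof.
move=> legK IK vu ut tv vt utK indI; have [I1|I1] := leqP #|I| 1.
  apply: leq_ltn_trans I1 _; move: s0; clear; lia.
have [dI [legI indI']] := independent_legs legK IK indI I1.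
have utI c : c \in I -> [/\ ~~ G u c, ~~ G u (d c), ~~ G t c & ~~ G t (d c)].
  by move/(subsetP IK); apply: utK.
have uI : u \notin I.
  apply/negP => uI; have [_ ud _ _] := legI _ uI.
  by have [_] := utI _ uI; rewrite ud.
pose d' x := if x == u then t else d x.
have d'u : d' u = t by rewrite /d' eqxx.
have d'I c : c \in I -> (c == u = false) * (d' c = d c).
  by move=> cI; have cu := memPn uI c cI; rewrite /d' (negPf cu).
have legI' : induced_legs G v (u |: I) d'.
  split=> [c|c c']; first by case/setU1P => [->|cI]; rewrite ?d'u // d'I //; apply: legI.
  case/setU1P => [->|cI] /setU1P[->|c'I]; rewrite ?eqxx // => ncc'.
  - by rewrite d'u d'I //; have [] := utI _ c'I.
  - rewrite d'u d'I //; have [] := utI _ cI.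
    by rewrite !(adj_sym _ _ c) !(adj_sym _ _ (d c)).
  - by rewrite !d'I //; apply: indI'.
have := free_legs freeG legI'; rewrite cardsU1 uI; clear; lia.
Qed.

Lemma attach_chains v K K' S a b Q :
    {in K, forall c, [/\ seg (S c) (a c) (b c), v \notin S c, square G v (a c)
       & G v (b c)]} ->
    {in K &, forall c c', c != c' -> [disjoint S c & S c']} ->
    K' \subset K -> path_cover (follows G a b) K' Q ->
  let us := map (chain v S a b) Q in
  [/\ attachable G s v us, disjoint_segments us & support us = \bigcup_(c in K') S c].
Proof.
move=> segK disK /subsetP K'K [aQ uQ fQ] us.
have QK : {subset flatten Q <= K} by move=> x; rewrite fQ; apply: K'K.
have segK' : {in K, forall c, seg (S c) (a c) (b c)} by move=> c /segK[].
split.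
- move=> u /mapP[p pQ ->]; have pp := allP aQ _ pQ.
  have pK : {subset p <= K} by move=> x xp; apply: QK; apply/flattenP; exists p.
  have up : uniq p.
    case/splitPr: pQ uQ {us aQ fQ QK pp pK} => Q1 Q2.
    by rewrite flatten_cat /= cat_uniq cat_uniq; case/and4P.
  split; first exact: (chain_segment v segK' disK pp up pK).
  + apply/negP; rewrite /= bigcup_seq => /bigcupP[c cp].
    by apply/negP; have [] := segK _ (pK _ cp).
  + case: p pp pK {pQ up} => // x p _ pK /=.
    by have [] := segK _ (pK _ (mem_head _ _)).
  + case: p pp pK {pQ up} => // x p _ pK /=.
    by have [] := segK _ (pK _ (mem_last _ _)).
- exact: (disjoint_segments_chains _ _ _ disK).
- by rewrite support_chains bigcup_seq; apply: eq_bigl.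
Qed.

Lemma path_cover_singletons (e : rel V) K : path_cover e K [seq [:: x] | x <- enum K].
Proof.
have fl : flatten [seq [:: x] | x <- enum K] = enum K by elim: (enum K) => //= x r ->.
split; first by apply/allP => p /mapP[x _ ->].
  by rewrite fl enum_uniq.
by move=> x; rewrite fl mem_enum.
Qed.

Lemma exit_chains v S a b Q e d :
  all (nepath e) Q -> d \in map snd (map (chain v S a b) Q) ->
  exists2 c, c \in flatten Q & d = b c.
Proof.
move=> aQ /mapP[u /mapP[p pQ ->] ->].
have := allP aQ _ pQ; case: p pQ => // x p pQ _.
exists (last x p) => //; apply/flattenP; exists (x :: p) => //.
exact: mem_last.
Qed.

(** The branch of a child [c] is entered at [d c] and left at [c]. *)
Definition branchable v K S d : Prop :=
  {in K, forall c, [/\ seg (S c) (d c) c, v \notin S c & leg v d c]} /\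
  {in K &, forall c c', c != c' -> [disjoint S c & S c']}.

Lemma branchable_attach v K S d : branchable v K S d ->
  {in K, forall c, [/\ seg (S c) (d c) (id c), v \notin S c, square G v (d c)
       & G v (id c)]}.
Proof.
case=> bK _ c /bK[sc vc lc]; split=> //; first exact: square_leg.
by case/andP: lc.
Qed.

Lemma branch_cover v K S d Q : branchable v K S d ->
    path_cover (follows G d id) K Q -> 0 < size Q < 2 * s ->
  exists2 d', d' \in K & seg (v |: \bigcup_(c in K) S c) d' v.
Proof.
move=> bK cQ szQ; have [aQ uQ fQ] := cQ.
have [au dus <-] := attach_chains (branchable_attach bK) (proj2 bK) (subxx K) cQ.
have [|d' d'us sd'] := hub _ au dus; first by rewrite size_map.
by exists d' => //; have [c + ->] := exit_chains aQ d'us; rewrite fQ.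
Qed.

Lemma path_cover_gt0 (e : rel V) K Q : K != set0 -> path_cover e K Q -> 0 < size Q.
Proof.
case/set0Pn => x xK [_ _ fQ]; case: Q fQ => // fQ.
by have := fQ x; rewrite xK.
Qed.

Lemma branch v K S d : branchable v K S d -> K != set0 ->
    (forall I, I \subset K -> independent (follows G d id) I -> #|I| < 2 * s) ->
  exists2 d', d' \in K & seg (v |: \bigcup_(c in K) S c) d' v.
Proof.
move=> bK K0 aK.
have [Q [I [cQ _ IK iI szQ]]] := Gallai_Milgram (path_cover_singletons (follows G d id) K).
by apply: (branch_cover bK cQ); rewrite (path_cover_gt0 K0 cQ) (leq_ltn_trans szQ) ?aK.
Qed.

(* Starting the Gallai--Milgram reduction from a small cover of the children
   not adjacent to [w], one of the [2s] paths must begin at a neighbour of [w];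
   that path can then be entered from [w] instead of from [v]. *)
Lemma branch_split v w K S d : branchable v K S d -> K != set0 ->
    (forall I, I \subset [set c in K | ~~ G w c] ->
       independent (follows G d id) I -> #|I| < 2 * s) ->
  (exists2 d', d' \in K & seg (v |: \bigcup_(c in K) S c) d' v) \/
  (exists2 x, x \in [set c in K | G w c] & seg (v |: \bigcup_(c in K) S c) (d x) v).
Proof.
move=> bK K0 aY; set Y := [set c in K | ~~ G w c] in aY *.
set X := [set c in K | G w c].
set e := follows G d id in aY *.
have [QY [IY [[aQY uQY fQY] _ IYY iIY szQY]]] :=
  Gallai_Milgram (path_cover_singletons e Y).
have [aX uX fX] := path_cover_singletons e X.
(* The first vertices of [Q] will lie in [X] or in [starts QY], and the latter are fewer than
   [2 * s]. *)
pose P := QY ++ [seq [:: x] | x <- enum X].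
have cP : path_cover e K P.
  split; first by rewrite all_cat aQY aX.
    rewrite flatten_cat cat_uniq uQY uX andbT; apply/hasPn => x.
    rewrite fX inE => /andP[_ Gx]; apply/negP => xQ.
    by have : x \in flatten QY by []; rewrite fQY inE Gx andbF.
  by move=> x; rewrite flatten_cat mem_cat fQY fX !inE; case: (x \in K); case: (G w x).
have [Q [I [cQ sQ IK iI szQ]]] := Gallai_Milgram cP.
have legK : {in K, forall c, leg v d c} by move=> c /(proj1 bK)[].
have szI := independence_star legK IK iI.
have [ltQ|geQ] := ltnP (size Q) (2 * s).
  by left; apply: (branch_cover bK cQ); rewrite (path_cover_gt0 K0 cQ).
right; have [aQ uQ fQ] := cQ.
have /hasP[x xQ xX] : has (mem X) (starts Q).
  apply/negPn/negP => /hasPn nX.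
  suff : size (starts Q) <= size (starts QY).
    rewrite (size_starts aQ) (size_starts aQY); apply/negP; rewrite -ltnNge.
    by apply: leq_ltn_trans szQY _; apply: leq_trans (aY _ IYY iIY) geQ.
  apply: uniq_leq_size; first exact: uniq_starts.
  move=> x xQ; have := sQ x xQ; rewrite /starts /P pmap_cat mem_cat => /orP[//|xX].
  have := nX x xQ; rewrite /= -fX => /negP[].
  exact: starts_sub_flatten xX.
exists x => //; have [p [R pQ]] := perm_starts xQ.
have cQ' := path_cover_perm pQ cQ.
have [] := attach_chains (branchable_attach bK) (proj2 bK) (subxx K) cQ'.
rewrite map_cons /=; set u := chain _ _ _ _ _; set us := map _ _ => au /andP[du dus].
rewrite support_cons => <-.
have aus : attachable G s v us by move=> z zus; apply: au; rewrite inE zus orbT.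
(* The path of [x] is set aside and the other [2 * s - 1] paths are attached to [v]. Their spare
   exit is then joined to the exit of the path of [x], whose entry [d x] stays free. *)
have [|d' d'us sd'] := hub _ aus dus.
  have szR : size R = (size Q).-1 by rewrite (perm_size pQ).
  rewrite size_map szR; move: geQ szQ szI s0; clear; lia.
have [ndu vd'] := exit_out (u := u) aus du d'us.
have uin : u \in u :: us by rewrite mem_head.
have [su vu _ vb] := au u uin.
have -> : v |: (u.1.1 :|: support us) = u.1.1 :|: (v |: support us) by rewrite setUCA.
apply: segment_cat su sd' _ _.
  by rewrite disjoint_sym; apply: (disjoint_hub au uin du).
by rewrite adj_sym; apply: (square_exits au uin vd' ndu).
Qed.
End Branches.

(** * The search tree, from the bottom up to distance two *)

Section Layers.
Variables (V : finType) (G : sgraph V) (s : nat).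
Hypothesis s0 : 0 < s.
Hypothesis freeG : free (subdivision (complete_bipartite 1 (2 * s + 1))) G.
Variables (r : V) (h : V -> nat).
Hypothesis hr : h r = 0.
Hypothesis h_adj : forall x y, G x y -> h y <= (h x).+1.
Hypothesis h_pred : forall x, x != r -> exists2 y, G y x & h x = (h y).+1.

Local Notation seg := (segment G (fun=> 2 * s)).

Lemma h_eq0 x : h x = 0 -> x = r.
Proof. by move=> hx; apply/eqP/negPn/negP => /h_pred[y _]; rewrite hx. Qed.

Lemma far_nadj x y : (h x).+1 < h y -> ~~ G x y.
Proof. by apply: contraL => /h_adj; rewrite -leqNgt. Qed.

Lemma h_eq1 x : (h x == 1) = G r x.
Proof.
apply/eqP/idP => [hx|rx].
  have [|y yx] := h_pred (x := x).
    by apply: contra_eqN hx => /eqP->; rewrite hr.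
  by rewrite hx => -[/esym/h_eq0 <-].
apply/eqP; rewrite eqn_leq -{1}hr h_adj // lt0n.
by apply: contraTneq rx => /h_eq0->; rewrite adj_irr.
Qed.

(** [S v] stands for the descendants of [v], entered at [d v] and left at [v]. At level [i] these
    sets partition the vertices at distance [i] or more from the root. *)
Definition layer i (S : V -> {set V}) (d : V -> V) : Prop :=
  [/\ forall v, h v = i ->
        [/\ seg (S v) (d v) v, d v = v -> S v = [set v],
          d v = v \/ G v (d v) /\ h (d v) = i.+1
        & forall x, x \in S v -> i <= h x],
      forall v w, h v = i -> h w = i -> v != w -> [disjoint S v & S w]
    & forall x, i <= h x -> exists2 v, h v = i & x \in S v].

Section Step.
Variables (i : nat) (S : V -> {set V}) (d p : V -> V).
Hypothesis layerS : layer i.+1 S d.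
Hypothesis pP : forall c, h c = i.+1 -> h (p c) = i /\ G (p c) c.

Definition kids v : {set V} := [set c | (h c == i.+1) && (p c == v)].
Definition descendants v : {set V} := v |: \bigcup_(c in kids v) S c.

Lemma kidsP v c : c \in kids v -> [/\ h c = i.+1, h v = i & G v c].
Proof. by rewrite inE => /andP[/eqP hc /eqP<-]; have [] := pP hc. Qed.

Lemma h_desc v c x : c \in kids v -> x \in S c -> i < h x.
Proof.
by case/kidsP=> hc _ _; have [L _ _] := layerS; have [_ _ _] := L c hc; apply.
Qed.

Lemma h_entry v c : c \in kids v -> i < h (d c).
Proof.
move=> cK; have [hc _ _] := kidsP cK; apply: (h_desc cK).
by have [L _ _] := layerS; have [[]] := L c hc.
Qed.

Lemma kids_entry_far u v c : c \in kids v -> (h u).+1 <= i -> ~~ G u (d c).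
Proof. by move=> /h_entry hd hu; apply: far_nadj; apply: leq_ltn_trans hd. Qed.

Lemma kids_entry_nadj u v c : c \in kids v -> h u = i -> ~~ G u c -> ~~ G u (d c).
Proof.
move=> cK hu nuc; have [hc _ _] := kidsP cK; have [L _ _] := layerS.
have [_ _ [->//|[_ hd]] _] := L c hc.
by apply: far_nadj; rewrite hu hd.
Qed.

Lemma kids_branchable v : branchable G s v (kids v) S d.
Proof.
have [L dis _] := layerS; split=> [c cK|c c' cK c'K].
  have [hc hv vc] := kidsP cK; have [sc _ dc lc] := L c hc; split=> //.
    by apply/negP => /(h_desc cK); rewrite hv ltnn.
  rewrite /leg vc /=; case: dc => [->|[cd hd]]; first by rewrite eqxx.
  rewrite cd far_nadj ?hv ?hd // andbT; apply/orP; right.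
  by apply: contra_eqN hd => /eqP->; rewrite hv; apply/eqP; clear; lia.
by apply: dis; [case: (kidsP cK)|case: (kidsP c'K)].
Qed.

Lemma h_descendants v x : h v = i -> x \in descendants v -> i <= h x.
Proof.
move=> hv /setU1P[->|/bigcupP[c cK xc]]; first by rewrite hv.
exact: ltnW (h_desc cK xc).
Qed.

Lemma disjoint_descendants v w : h v = i -> h w = i -> v != w ->
  [disjoint descendants v & descendants w].
Proof.
move=> hv hw nvw; rewrite -setI_eq0; apply/eqP/setP=> x; rewrite !in_setI in_set0.
apply/negP => /andP[/setU1P[->|/bigcupP[c cK xc]]].
  case/setU1P=> [vw|/bigcupP[c cK]]; first by rewrite vw eqxx in nvw.
  by move/(h_desc cK); rewrite hv ltnn.
case/setU1P=> [xw|/bigcupP[c' c'K xc']].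
  by move/(h_desc cK): xc; rewrite xw hw ltnn.
have [_ dis _] := layerS; have [hc _ _] := kidsP cK; have [hc' _ _] := kidsP c'K.
have [cc'|ncc'] := eqVneq c c'.
  move: cK c'K nvw; rewrite !inE cc' => /andP[_ /eqP<-] /andP[_ /eqP<-].
  by rewrite eqxx.
by have := disjointFr (dis _ _ hc hc' ncc') xc; rewrite xc'.
Qed.

Lemma cover_descendants x : i <= h x -> exists2 v, h v = i & x \in descendants v.
Proof.
rewrite leq_eqVlt => /orP[/eqP hx|hx]; first by exists x; rewrite ?setU11.
have [_ _ cov] := layerS; have [c hc xc] := cov x hx; have [hpc _] := pP hc.
exists (p c) => //; apply/setU1P; right; apply/bigcupP; exists c => //.
by rewrite inE hc !eqxx.
Qed.

Lemma kids0_descendants v : kids v = set0 -> descendants v = [set v].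
Proof. by rewrite /descendants => ->; rewrite big_set0 setU0. Qed.

Lemma layer_step :
    (forall v, h v = i -> kids v != set0 ->
       exists2 d', d' \in kids v & seg (descendants v) d' v) ->
  exists d', layer i descendants d'.
Proof.
move=> bK; have exd v : exists x, h v = i ->
    [/\ seg (descendants v) x v, x = v -> descendants v = [set v],
      x = v \/ G v x /\ h x = i.+1 & forall x, x \in descendants v -> i <= h x].
  have [hv|/eqP hv] := eqVneq (h v) i; last by exists v.
  have [K0|K0] := eqVneq (kids v) set0.
    exists v => _; rewrite kids0_descendants //; split=> //.
    - by apply: segment1; rewrite leq_pmulr.
    - by left.
    - by move=> x /set1P->; rewrite hv.
  have [x xK sx] := bK v hv K0; have [hx _ vx] := kidsP xK; exists x => _; split=> //.
  - by move=> xv; rewrite xv adj_irr in vx.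
  - by right.
  - by move=> y; apply: h_descendants.
have [d' d'P] := fin_all_exists exd; exists d'; split=> //.
- exact: disjoint_descendants.
- exact: cover_descendants.
Qed.
End Step.

Lemma layer2 : exists S d, layer 2 S d.
Proof.
have exp x : exists y, x != r -> G y x /\ h x = (h y).+1.
  have [->|/h_pred[y yx hy]] := eqVneq x r; first by exists r.
  by exists y.
have [p pP] := fin_all_exists exp.
have h_neq x : 0 < h x -> x != r by apply: contraTneq => ->; rewrite hr.
(* No vertex has height [M], so the induction starts from an empty layer. *)
pose M := (\max_x h x).+3.
suff step k i : i + k = M -> 2 <= i -> exists S d, layer i S d.
  by apply: (step (M - 2)); rewrite ?subnKC.
elim: k i => [|k IH] i; rewrite ?addn0 ?addnS.
  move=> -> _; have hM x : h x < M.
    by rewrite /M !ltnS; apply: leq_trans (leq_bigmax x) _; rewrite 2?leqW.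
  exists (fun v => [set v]), id; split=> [v hv|v w hv|x] //.
  - by have := hM v; rewrite hv ltnn.
  - by have := hM v; rewrite hv ltnn.
  - by rewrite leqNgt hM.
move=> ik i2; have [||S [d LS]] := IH i.+1; rewrite ?addSn // 1?leqW //.
have pL c : h c = i.+1 -> h (p c) = i /\ G (p c) c.
  move=> hc; have [|gc] := pP c; first by apply: h_neq; rewrite hc.
  by rewrite hc => -[->].
have [|d' Ld'] := layer_step LS pL; last by exists (descendants i S p), d'.
move=> v hv K0; have bK := kids_branchable LS pL v.
(* The parent of [v] and its own parent form the further leg; they lie too high to be adjacent to a
   child of [v] or its entry. *)
have [vu hu] : G (p v) v /\ h v = (h (p v)).+1.
  by apply/pP/h_neq; rewrite hv (leq_trans _ i2).
have [ut ht] : G (p (p v)) (p v) /\ h (p v) = (h (p (p v))).+1.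
  by apply/pP/h_neq; move: i2; rewrite -hv hu.
apply: (branch bK K0) => I IK indI.
apply: (independence_upleg s0 freeG (v := v) (u := p v) (t := p (p v)) _ IK _ _ _ _ _ indI).
- by move=> c /(proj1 bK)[].
- by rewrite adj_sym.
- by rewrite adj_sym.
- by apply: contra_eqN hu => /eqP E; rewrite ht E; apply/eqP; clear; lia.
- by rewrite adj_sym far_nadj // hu ht.
- move=> c cK; have [hc _ _] := kidsP pL cK; split.
  + by apply: far_nadj; rewrite hc -hv hu.
  + by apply: (kids_entry_far LS pL cK); rewrite -?hv ?hu.
  + by apply: far_nadj; rewrite hc -hv hu ht; clear; lia.
  + by apply: (kids_entry_far LS pL cK); rewrite -?hv ?hu ?ht; clear; lia.
Qed.

(** The complement of the graph induced on the neighbourhood of [r]. Neighbours of [r] in different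
    components are adjacent in [G]. *)
Definition co : rel V := fun x y => [&& h x == 1, h y == 1, x != y & ~~ G x y].

Lemma co_sym : symmetric co.
Proof.
by move=> x y; rewrite /co (eq_sym x) adj_sym; case: (h x == 1); case: (h y == 1).
Qed.

Local Notation rt := (root co).

(** * Branches of the neighbours of the root *)

Section Root.
Hypothesis r_max : forall x, degree G x <= degree G r.
Variables (S : V -> {set V}) (d p mate : V -> V) (key : V -> nat).
Hypothesis layerS : layer 2 S d.
Hypothesis pP : forall c, h c = 2 -> h (p c) = 1 /\ G (p c) c.
Hypothesis p_min : forall c w, h c = 2 -> h w = 1 -> G w c -> key (p c) <= key w.
Hypothesis mateP : forall w v, co (rt w) v -> co (rt w) (mate (rt w)).
Hypothesis key_step : forall w, w != rt w -> exists2 w', co w' w & key w' < key w.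
Hypothesis key_mate : forall w, w != rt w -> w != mate (rt w) ->
  key (mate (rt w)) < key w.

Local Notation kids := (kids 1 p).
Local Notation desc := (descendants 1 S p).

Lemma kids_earlier w' w c : c \in kids w -> h w' = 1 -> key w' < key w -> ~~ G w' c.
Proof.
move=> cK hw' ltk; have [hc _ _] := kidsP pP cK.
move: cK ltk; rewrite inE => /andP[_ /eqP<-]; rewrite ltnNge.
by apply: contra => w'c; apply: p_min.
Qed.

(** The further leg of [w] runs through [r] to its non-neighbour [w']. *)
Lemma independence_co w w' (I K : {set V}) : co w' w -> K \subset kids w ->
    {in K, forall c, ~~ G w' c} ->
  I \subset K -> independent (follows G d id) I -> #|I| < 2 * s.
Proof.
case/and4P=> /eqP hw' /eqP hw nww' ngw /subsetP KK w'K IK indI.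
have rw x : h x = 1 -> G r x by move/eqP; rewrite h_eq1.
apply: (independence_upleg s0 freeG (v := w) (u := r) (t := w') _ IK _ _ _ _ _ indI).
- by move=> c /KK cK; have [/(_ c cK)[]] := kids_branchable layerS pP w.
- by rewrite adj_sym rw.
- exact: rw.
- by [].
- by rewrite adj_sym.
- move=> c cK; have cKw := KK c cK; have [hc _ _] := kidsP pP cKw; split.
  + by apply: far_nadj; rewrite hr hc.
  + by apply: (kids_entry_far layerS pP cKw); rewrite hr.
  + exact: w'K.
  + exact: (kids_entry_nadj layerS pP cKw hw' (w'K c cK)).
Qed.

(** Otherwise [w] is isolated in [co], hence adjacent in [G] to [r], to all other neighbours of [r]
    and to a child, so its degree exceeds the maximum. *)
Lemma root_mate w : h w = 1 -> w = rt w -> kids w != set0 -> co w (mate w).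
Proof.
move=> hw wr /set0Pn[c cK]; have [hc _ wc] := kidsP pP cK.
have [[v cov]|nco] := altP (existsPP (fun v => @idP (co w v))).
  by rewrite wr; apply: (mateP (v := v)); rewrite -wr.
have := r_max w; rewrite leqNgt => /negP[]; rewrite /degree.
have wN : w \in [set y | G r y] by rewrite inE -h_eq1 hw.
rewrite (cardsD1 w) wN add1n.
have sub : r |: (c |: ([set y | G r y] :\ w)) \subset [set y | G w y].
  apply/subsetP => y; rewrite !inE => /or3P[/eqP->|/eqP->//|/andP[yw ry]].
    by rewrite adj_sym -h_eq1 hw.
  apply: contraNT nco => nwy; apply/existsP; exists y.
  by rewrite /co hw h_eq1 ry eq_sym yw nwy.
apply: leq_trans (subset_leq_card sub).
rewrite !cardsU1 !inE adj_irr andbF orbF.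
have -> : (r == c) = false by apply/eqP => rc; move: hc; rewrite -rc hr.
have -> : G r c = false by rewrite -h_eq1 hc.
by rewrite andbF.
Qed.

(** If [w] is not first in its component, an earlier non-neighbour gives the further leg. If it is,
    the leg through [mate w] serves only the children not adjacent to [mate w], whence
    [branch_split]. *)
Lemma level1_branch w : h w = 1 -> kids w != set0 ->
  (exists2 x, x \in kids w & seg (desc w) x w) \/
  [/\ w = rt w, co w (mate w)
    & exists2 x, square G (mate w) x & seg (desc w) x w].
Proof.
move=> hw K0; have bK := kids_branchable layerS pP w.
have [wr|wr] := eqVneq w (rt w); last first.
  have [w' cow' ltk] := key_step wr; left; apply: (branch bK K0) => I.
  apply: (independence_co cow' (subxx _)) => c cK.
  by apply: (kids_earlier cK _ ltk); have /and4P[/eqP] := cow'.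
have com := root_mate hw wr K0.
have [] := branch_split (w := mate w) s0 freeG bK K0.
- move=> I; apply: (@independence_co w (mate w)); first by rewrite co_sym.
    by apply/subsetP => c; rewrite inE => /andP[].
  by move=> c; rewrite inE => /andP[].
- by left.
- case=> x; rewrite inE => /andP[xK mx] sx; right; split=> //; exists (d x) => //.
  have [hx _ _] := kidsP pP xK; have [L _ _] := layerS; have [_ _ dx _] := L x hx.
  case: dx => [->|[xd hd]]; first exact: square1.
  apply: (square2 (z := x)) => //; last by rewrite adj_sym.
  apply: contra_eqN hd => /eqP<-; have /and4P[_ /eqP-> _ _] := com.
  by [].
Qed.

(** * Assembling the factor at the root *)

Section Assembly.
Variables (sp : V -> bool) (a : V -> V).
Hypothesis spP : forall w, h w = 1 -> sp w ->
  [/\ w = rt w, co w (mate w), square G (mate w) (a w) & seg (desc w) (a w) w].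
Hypothesis nspP : forall w, h w = 1 -> ~~ sp w ->
  [/\ seg (desc w) (a w) w, a w = w -> desc w = [set w]
    & a w = w \/ a w \in kids w].

(* [sp t] holds for the first vertices [t] that are linked to their mate; such a
   [t] is not a node of its own. *)
Definition nodes : {set V} := [set w | (h w == 1) && ~~ sp w].
(** The branch of the linked vertex [rt w] is appended to that of its mate [w], so the exit moves to
    [rt w]. *)
Definition merged w : bool := [&& h (rt w) == 1, sp (rt w) & w == mate (rt w)].
Definition node_set w : {set V} := if merged w then desc w :|: desc (rt w) else desc w.
Definition node_exit w : V := if merged w then rt w else w.

Lemma nodesP w : w \in nodes -> h w = 1 /\ ~~ sp w.
Proof. by rewrite inE => /andP[/eqP]. Qed.

Lemma co_root x y : co x y -> rt x = rt y.
Proof.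
move=> xy; apply/eqP; rewrite root_connect ?connect1 //.
exact: sym_connect_sym co_sym.
Qed.

(** Linked vertices are first in their components, and [mate t] lies in the component of [t] without
    being [t]. *)
Lemma mate_node t : h t = 1 -> sp t ->
  [/\ mate t \in nodes, merged (mate t) & rt (mate t) = t].
Proof.
move=> ht spt; have [tr com _ _] := spP ht spt.
have rm : rt (mate t) = t by rewrite -(co_root com).
have /and4P[_ hm ntm _] := com; rewrite /merged rm inE hm ht spt !eqxx.
split=> //=; apply/negP => spm; have [mr _ _ _] := spP (eqP hm) spm.
by move: ntm; rewrite mr rm eqxx.
Qed.

Lemma mergedP w : w \in nodes -> merged w ->
  [/\ h (rt w) = 1, sp (rt w), co (rt w) w & w = mate (rt w)].
Proof.
move=> wN /and3P[/eqP hr1 sr /eqP wm]; split=> //.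
by have [_ + _ _] := spP hr1 sr; rewrite -wm.
Qed.

Lemma node_leg w : w \in nodes -> leg G r a w.
Proof.
case/nodesP=> hw sw; have [_ _ aw] := nspP hw sw.
rewrite /leg -h_eq1 hw eqxx /=; case: aw => [->|aK]; first by rewrite eqxx.
have [ha _ wa] := kidsP pP aK; rewrite wa -h_eq1 ha andbT; apply/orP; right.
by apply: contra_eqN ha => /eqP->; rewrite hr.
Qed.

Lemma h_exit w : w \in nodes -> h (node_exit w) = 1.
Proof.
move=> wN; rewrite /node_exit; case: ifP => [/(mergedP wN)[]//|_].
by have [] := nodesP wN.
Qed.

Lemma node_segment w : w \in nodes ->
  [/\ seg (node_set w) (a w) (node_exit w), r \notin node_set w,
    square G r (a w) & G r (node_exit w)].
Proof.
move=> wN; have [hw sw] := nodesP wN; have [sgw _ _] := nspP hw sw.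
have rd x : h x = 1 -> r \notin desc x.
  by move=> hx; apply/negP => /(h_descendants layerS pP hx); rewrite hr.
split; last by rewrite -h_eq1 h_exit.
- rewrite /node_set /node_exit; case: ifP => // /(mergedP wN)[hr1 sr cor wm].
  have [_ _ sqm st] := spP hr1 sr.
  apply: (segment_cat sgw st); last by rewrite -wm in sqm.
  apply: (disjoint_descendants layerS pP) => //.
  by have /and4P[_ _] := cor; rewrite eq_sym.
- rewrite /node_set; case: ifP => [/(mergedP wN)[hr1 _ _ _]|_]; last exact: rd.
  by rewrite inE negb_or !rd.
- exact: square_leg (node_leg wN).
Qed.

Lemma node_setP w x : w \in nodes -> x \in node_set w ->
  exists2 y, h y = 1 & x \in desc y /\ (y = w \/ [/\ sp y, y = rt w & w = mate y]).
Proof.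
move=> wN; have [hw _] := nodesP wN; rewrite /node_set; case: ifP; last first.
  by move=> _ xw; exists w => //; split=> //; left.
case/(mergedP wN)=> hr1 sr _ wm /setUP[xw|xr]; first by exists w => //; split=> //; left.
by exists (rt w) => //; split=> //; right.
Qed.

Lemma disjoint_nodes : {in nodes &, forall w w', w != w' ->
  [disjoint node_set w & node_set w']}.
Proof.
move=> w w' wN w'N nww'; rewrite -setI_eq0; apply/eqP/setP=> x.
rewrite !inE; apply/negP => /andP[/(node_setP wN)[y hy [xy yw]]].
case/(node_setP w'N)=> y' hy' [xy' y'w'].
have yy' : y = y'.
  apply/eqP/negPn/negP => nyy'.
  by have := disjointFr (disjoint_descendants layerS pP hy hy' nyy') xy; rewrite xy'.
rewrite -{}yy' {y' hy' xy'} in y'w'; have [_ sw] := nodesP wN.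
have [_ sw'] := nodesP w'N; move/eqP: nww'; apply.
case: yw y'w' => [->|[sy yr ->]] [wy|[sy' _ w'y]].
- by [].
- by rewrite sy' in sw.
- by rewrite -wy sy in sw'.
- by rewrite w'y.
Qed.

Lemma cover_nodes : r |: \bigcup_(w in nodes) node_set w = setT.
Proof.
apply/setP=> x; rewrite !inE; have [//|xr /=] := eqVneq x r.
apply/bigcupP; have hx : 0 < h x.
  by rewrite lt0n; apply: contraNneq xr => /h_eq0->.
have [w hw xw] := cover_descendants layerS pP hx.
case sw: (sp w); last first.
  exists w; first by rewrite inE hw sw.
  by rewrite /node_set; case: ifP => _ //; rewrite inE xw.
have [mN mm rm] := mate_node hw sw; exists (mate w) => //.
by rewrite /node_set mm rm inE xw orbT.
Qed.

Local Notation nfollows := (follows G a node_exit).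

(** In different components [rt w] and [w'] would be adjacent in [G], which puts [rt w] within
    distance two of [a w']. *)
Lemma merged_same_root w w' : w \in nodes -> w' \in nodes -> merged w ->
  ~~ square G (rt w) (a w') -> rt w' = rt w.
Proof.
move=> wN w'N mw; have [hr1 sr cor _] := mergedP wN mw; have [hw' sw'] := nodesP w'N.
have nrw' : rt w != w' by apply: contraNneq sw' => <-.
have rrt : rt (rt w) = rt w by rewrite (co_root cor).
apply: contraNeq => nr; have rw' : G (rt w) w'.
  apply: contraNT nr => nG; have := @co_root (rt w) w'.
  by rewrite /co hr1 hw' !eqxx nrw' nG rrt => ->.
have [_ _ [->|aK]] := nspP hw' sw'; first exact: square1.
have [ha _ w'a] := kidsP pP aK; apply: (square2 (z := w')) => //.
  by apply: contra_eqN ha => /eqP<-; rewrite hr1.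
by rewrite adj_sym.
Qed.

Lemma nodes_apart w w' : w \in nodes -> w' \in nodes -> w != w' ->
    ~~ merged w' -> ~~ nfollows w w' -> ~~ nfollows w' w ->
  [/\ a w != w, a w' != w', ~~ G w w'
    & [/\ ~~ G w (a w'), ~~ G w' (a w) & ~~ G (a w) (a w')]].
Proof.
move=> wN w'N nww' mw' f1 f2; have lw := node_leg wN; have lw' := node_leg w'N.
have nw'w : w' != w by rewrite eq_sym.
have f2' : ~~ follows G a id w' w.
  by move: f2; rewrite /follows /node_exit (negPf mw').
have [aw gw'w gw'a /implyP gaa] := legs_apart lw' lw nw'w f2'.
suff [aw' gwa] : a w' != w' /\ ~~ G w (a w').
  by split=> //; first rewrite adj_sym; last (split=> //; rewrite adj_sym; apply: gaa).
have [mw|mw] := boolP (merged w); last first.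
  have f1' : ~~ follows G a id w w'.
    by move: f1; rewrite /follows /node_exit (negPf mw).
  by have [] := legs_apart lw lw' nww' f1'.
have [hr1 sr cor wm] := mergedP wN mw; have [hw' sw'] := nodesP w'N.
have nsq : ~~ square G (rt w) (a w').
  by move: f1; rewrite /follows /node_exit mw nww'.
have rr := merged_same_root wN w'N mw nsq.
have rw'w' : w' != rt w' by rewrite rr; apply: contraNneq sw' => ->.
have aw' : a w' != w'.
  apply: contraNneq nsq => ->; apply: (square2 (z := r)).
  - by rewrite -rr eq_sym.
  - by rewrite -h_eq1 hr1.
  - by rewrite -h_eq1 hw'.
split=> //; have [_ _ [/eqP|aK]] := nspP hw' sw'; first by rewrite (negPf aw').
(* [w] is the mate in the component of [w'], so its key is smaller and the child [a w'] would have
   been given to another parent. *)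
apply: (kids_earlier aK); first by have [] := nodesP wN.
by rewrite wm -rr; apply: key_mate; rewrite // rr -wm.
Qed.

Lemma independence_nodes (I : {set V}) : I \subset nodes ->
  independent nfollows I -> #|I| <= 2 * s.
Proof.
move=> /subsetP IN indI; have [I1|I1] := leqP #|I| 1.
  by apply: leq_trans I1 _; rewrite muln_gt0.
have apart w w' : w \in I -> w' \in I -> w != w' ->
    [/\ a w != w, a w' != w', ~~ G w w'
      & [/\ ~~ G w (a w'), ~~ G w' (a w) & ~~ G (a w) (a w')]].
  move=> wI w'I nww'; have nw'w : w' != w by rewrite eq_sym.
  have f1 := indI w w' wI w'I nww'; have f2 := indI w' w w'I wI nw'w.
  have [wN w'N] := (IN w wI, IN w' w'I).
  have [mw'|mw'] := boolP (merged w'); last exact: nodes_apart.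
  have [mw|mw] := boolP (merged w); last first.
    have [? ? ? [? ? ?]] := nodes_apart w'N wN nw'w mw f2 f1.
    by split=> //; [rewrite adj_sym | split=> //; rewrite adj_sym].
  (* Two merged nodes without an arc would be mates of the same vertex, hence equal. *)
  have nsq : ~~ square G (rt w) (a w').
    by move: f1; rewrite /follows /node_exit mw nww'.
  have rr := merged_same_root wN w'N mw nsq.
  have [_ _ _ wm] := mergedP wN mw; have [_ _ _ w'm] := mergedP w'N mw'.
  by rewrite wm w'm rr eqxx in nww'.
have legI : induced_legs G r I a.
  split=> [w wI|w w' wI w'I nww']; last by have [_ _ ? []] := apart w w' wI w'I nww'.
  have [w' w'I nw'w] : exists2 w', w' \in I & w' != w.
    have /card_gt0P[w'] : 0 < #|I :\ w| by move: I1; rewrite (cardsD1 w) wI.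
    by rewrite !inE => /andP[nw'w w'I]; exists w'.
  have [_ aw _ _] := apart w' w w'I wI nw'w.
  have /andP[rw] := node_leg (IN w wI); rewrite (negPf aw) /=.
  by case/and3P.
by have := free_legs freeG legI; rewrite addn1.
Qed.

(** There can be [2 * s] chains, one more than [hub] admits: one chain is left out of the hub and
    used to close up the graph. *)
Lemma nodes_factor : 3 <= #|V| -> exists F : sgraph V, is_2_2s_factor s (square G) F.
Proof.
move=> V3; suff [F [sqF _ cF] dF] : exists2 F, spans G setT F &
    {in setT, forall x, ~~ odd (degree F x) /\ degree F x <= 2 * s}.
  exists F; split.
  - by split=> // x; have [] := dF x (in_setT x).
  - by split=> [|x y]; [apply: leq_trans V3|apply: cF].
  - by move=> x; have [] := dF x (in_setT x).
have [Q [I [cQ _ IN iI szQ]]] :=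
  Gallai_Milgram (path_cover_singletons nfollows nodes).
have szQ' := leq_trans szQ (independence_nodes IN iI).
have [au dus supp] := attach_chains node_segment disjoint_nodes (subxx nodes) cQ.
have [aQ uQ fQ] := cQ; move: au dus supp; set us := map _ Q => au dus supp.
have szus : size us <= 2 * s by rewrite size_map.
rewrite -cover_nodes -supp.
case E: us au dus supp szus => [|u us'] au dus supp szus.
  by move: V3; rewrite -cardsT -cover_nodes -supp /support big_nil setU0 cards1.
have /andP[du dus'] := dus; have uin : u \in u :: us' by rewrite mem_head.
have [su ru squ rbu] := au u uin.
have aus' : attachable G s r us' by move=> w ws; apply: au; rewrite inE ws orbT.
have -> : r |: support (u :: us') = (r |: support us') :|: u.1.1.
  by rewrite support_cons setUCA setUC.
have dis := disjoint_hub au uin du.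
have [us'0|us'0] := posnP (size us'); last first.
  have [|e eus se] := hub _ aus' dus'; first by rewrite us'0.
  have [neu re] := exit_out aus' du eus.
  apply: (segment_close se su dis squ (square_exits au uin re neu)).
  by rewrite xpair_eqE eq_sym (negPf (adj_neq re)).
(* A single chain is joined to [r] by its entry and its exit. These differ, since otherwise the
   chain is one vertex [x] with branch [[set x]], and [V] has only two vertices. *)
have us'E := size0nil us'0; rewrite us'E /support big_nil setU0 in dis *.
have s1 : seg [set r] r r by apply: segment1; rewrite leq_pmulr.
apply: (segment_close s1 su dis squ (square1 rbu)).
rewrite xpair_eqE eqxx /=; apply/negP => /eqP ba.
rewrite us'E {}/us in E.
case: Q aQ uQ fQ E {cQ szQ szQ'} => // q [|//] /=; rewrite andbT cats0.
case: q => // x q _ uq fq [uE].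
have xN : x \in nodes by rewrite -fq mem_head.
have yN : last x q \in nodes by rewrite -fq mem_last.
have [hx sx] := nodesP xN; have [sgx dx0 ax] := nspP hx sx.
(* Exits have height 1 and children of [x] height 2, so an entry equal to the exit must be [x]
   itself. *)
have hax : h (a x) = 1 by rewrite -(h_exit yN); move: ba; rewrite -uE /= => ->.
have {}ax : a x = x by case: ax => // /(kidsP pP)[+ _ _]; rewrite hax.
have my : ~~ merged (last x q).
  apply/negP => my; have [_ sr _ _] := mergedP yN my.
  by move: ba; rewrite -uE /= /node_exit my ax => rx; rewrite rx (negPf sx) in sr.
have yx : last x q = x by move: ba; rewrite -uE /= /node_exit (negPf my) ax.
have q0 : q = [::].
  case: q yx uq {fq uE yN my} => // y q /= yx /andP[+ _].
  by rewrite -{1}yx mem_last.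
move: V3; rewrite -cardsT -cover_nodes -supp us'E support_cons -uE q0 /= big_seq1.
rewrite /support big_nil setU0 /node_set; rewrite q0 /= in my; rewrite (negPf my).
by rewrite (dx0 ax) cards2; case: (r != x).
Qed.
End Assembly.

Lemma root_factor : 3 <= #|V| -> exists F : sgraph V, is_2_2s_factor s (square G) F.
Proof.
move=> V3; have exk w : exists k : bool * V, h w = 1 ->
    if k.1 then [/\ w = rt w, co w (mate w), square G (mate w) k.2 & seg (desc w) k.2 w]
    else [/\ seg (desc w) k.2 w, k.2 = w -> desc w = [set w]
           & k.2 = w \/ k.2 \in kids w].
  have [hw|/eqP hw] := eqVneq (h w) 1; last by exists (true, w).
  have [K0|K0] := eqVneq (kids w) set0.
    exists (false, w) => _ /=; rewrite kids0_descendants //; split=> //; last by left.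
    by apply: segment1; rewrite leq_pmulr.
  have [[x xK sx]|[wr com [x mx sx]]] := level1_branch hw K0.
    exists (false, x) => _; split=> //=; last by right.
    by have [_ _ wx] := kidsP pP xK => xw; rewrite xw adj_irr in wx.
  by exists (true, x).
have [k kP] := fin_all_exists exk.
apply: (@nodes_factor (fun w => (k w).1) (fun w => (k w).2)) => // w hw kw.
  by have := kP w hw; rewrite kw.
by have := kP w hw; rewrite (negPf kw).
Qed.
End Root.
End Layers.

(** * Choice of the root, the order and the parents *)

Theorem theorem1 (s : nat) (V : finType) (G : sgraph V) :
  0 < s ->
  connected G ->
  free (subdivision (complete_bipartite 1 (2 * s + 1))) G ->
  3 <= #|V| ->
  exists F : sgraph V, is_2_2s_factor s (square G) F.
Proof.
move=> s0 [V0 cG] freeG V3; have /card_gt0P[x0 _] := V0.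
pose r := [arg max_(x > x0) degree G x].
have r_max x : degree G x <= degree G r by rewrite /r; case: arg_maxnP => // y _; apply.
have [h [hr h_adj' h_pred']] := layering G r.
have h_adj x y : G x y -> h y <= (h x).+1 by apply: h_adj'.
have h_pred x : x != r -> exists2 y, G y x & h x = (h y).+1.
  by case/(h_pred' x (cG r x)) => y yx [_ hx]; exists y.
have [S [d layerS]] := layer2 s0 freeG hr h_adj h_pred.
have [mate [key [mateP key_step key_mate]]] := component_order (co_sym G h).
(* A vertex at distance two is given to its neighbour of least key in the first layer. *)
have exp c : exists w, h c = 2 -> [/\ h w = 1, G w c &
    forall w', h w' = 1 -> G w' c -> key w <= key w'].
  have [hc|/eqP hc] := eqVneq (h c) 2; last by exists c.
  have [|w wc hw] := h_pred c; first by apply: contra_eqN hc => /eqP->; rewrite hr.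
  have w1 : (h w == 1) && G w c by rewrite wc andbT -eqSS -hw hc.
  case: (@arg_minnP _ w (fun z => (h z == 1) && G z c) key w1).
  move=> y /andP[/eqP hy yc] ymin; exists y => _; split=> //.
  by move=> w' hw' w'c; apply: ymin; rewrite hw' w'c.
have [p pP] := fin_all_exists exp.
apply: (root_factor (p := p) s0 freeG hr h_adj h_pred r_max layerS
          _ _ mateP key_step key_mate V3).
- by move=> c /pP[? ? _].
- by move=> c w /pP[_ _ pm] hw; apply: pm.
Qed.
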